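(* Let $L$ be a nondegenerate homogeneous linear pencil in $g$ variables and let $\tilde L$ be a minimal dimensional defining pencil for $\mathcal B_L$. If $f:\mathcal B_L\to\mathcal M_{\ell',\ell}$ is a pencil ball map with $f(0)=0$, then there exist $m',m\in\mathbb N_0$, unitaries $U\in\mathbb C^{\ell'\times\ell'}$ and $V\in\mathbb C^{\ell\times\ell}$, and a contraction-valued analytic $\tilde f:\mathcal B_L\to\mathcal M_{m',m}$ such that $$f(x)=U\begin{pmatrix}\tilde L(x)&0\\0&\tilde f(x)\end{pmatrix}V^*.$$
   Context: Pencils. A $d'\times d$ homogeneous linear pencil in $g$ variables is $L(x)=\sum_{j=1}^g A_jx_j$ with $A_j\in\mathbb C^{d'\times d}$. For $X=(X_1,\dots,X_g)\in(\mathbb C^{n\times n})^g$ put $L(X)=\sum_j A_j\otimes X_j$; $\|\cdot\|$ is the operator norm. $L$ is nondegenerate if for all $n$ and all $X\in(\mathbb C^{n\times n})^g$, $L(X)=0$ implies $X=0$. The pencil ball is $\mathcal B_L=(\mathcal B_L(n))_{n\in\mathbb N}$ with $\mathcal B_L(n)=\{X\in(\mathbb C^{n\times n})^g:\|L(X)\|<1\}$, and its boundary is $\partial\mathcal B_L=(\partial\mathcal B_L(n))_{n}$ with $\partial\mathcal B_L(n)=\{X:\|L(X)\|=1\}$. Pencils $L,\tilde L$ (in the same variables, possibly of different sizes) are equivalent if $\|L(X)\|=\|\tilde L(X)\|$ for all $n$ and $X$, i.e. $\mathcal B_L=\mathcal B_{\tilde L}$. A nondegenerate $p'\times p$ homogeneous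 linear pencil $\tilde L$ is a minimal dimensional defining pencil for a ball if every nondegenerate $d'\times d$ homogeneous linear pencil $L$ with $\mathcal B_L=\mathcal B_{\tilde L}$ satisfies $p'p\le d'd$; it is a minimal dimensional defining pencil for $\mathcal B_L$ if moreover $\mathcal B_{\tilde L}=\mathcal B_L$. Analytic maps. $\mathcal M_{\ell',\ell}=((\mathbb C^{n\times n})^{\ell'\times\ell})_{n\in\mathbb N}$. Let $\langle x\rangle$ be the set of words in the noncommuting variables $x_1,\dots,x_g$ (including the empty word). A formal power series $f=\sum_{m\ge0}\sum_{|w|=m}f_ww$ with $f_w\in\mathbb C^{\ell'\times\ell}$ is evaluated at $X\in(\mathbb C^{n\times n})^g$ by $f(X)=\sum_{m=0}^\infty\sum_{|w|=m}f_w\otimes w(X)$ (summed in this order), where $w(X)=X_{j_1}\cdots X_{j_k}$ for $w=x_{j_1}\cdots x_{j_k}$. It is analytic on $\mathcal B_L$, written $f:\mathcal B_L\to\mathcal M_{\ell',\ell}$, if the series converges for all $n$ and all $X\in\mathcal B_L(n)$; it is contraction-valued if $\|f(X)\|\le1$ for all $X\in\mathcal B_L$. If $f$ is contraction-valued and $X\in\partial\mathcal B_L(n)$, the bounded analytic function $z\mapsto f(zX)$ on the unit disc has boundary values $f(\exp(it)X)$ for almost every $t$ (Fatou). A pencil ball map is a contraction-valued analytic $f$ with $\|f(\exp(it)X)\|=1$ for a.e. $t$, for every $n$ and every $X\in\partial\mathcal B_L(n)$. Blocks of size $0$ are allowed: if $m=0$ and/or $m'=0$ the corresponding block columns and/or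 rows are absent. *)

(* Defs.v *)
From mathcomp Require Import all_boot all_order all_algebra.
From mathcomp Require Import all_classical all_reals all_analysis.
From mathcomp.real_closed Require Import complex.
From mathcomp.real_closed Require mxtens.

Set Implicit Arguments.
Unset Strict Implicit.
Unset Printing Implicit Defensive.

Import Order.TTheory GRing.Theory Num.Theory.
Import numFieldNormedType.Exports.

Local Open Scope classical_set_scope.
Local Open Scope ring_scope.
Local Open Scope complex_scope.

(* MathComp-Analysis attaches its topology to abstract [numClosedFieldType]s
   only; going through this constant lets it be found on matrices over R[i]. *)
Definition Cplx (R : realType) : numClosedFieldType := R[i].

Local Notation "A *t B" := (mxtens.tensmx A B)
  (at level 40, left associativity).

Definition l2norm (R : realType) (n : nat) (v : 'cV[Cplx R]_n) : R :=
  Num.sqrt (\sum_i ComplexField.Normc.normc (v i 0) ^+ 2).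

Definition opnorm (R : realType) (m n : nat) (A : 'M[Cplx R]_(m, n)) : R :=
  sup [set l2norm (A *m v) | v in [set v | l2norm v <= 1]].

Definition mxtuple (R : realType) (g n : nat) := {ffun 'I_g -> 'M[Cplx R]_n}.

Definition pencil (R : realType) (d' d g : nat) :=
  {ffun 'I_g -> 'M[Cplx R]_(d', d)}.

Definition pencil_eval (R : realType) (d' d g : nat) (L : pencil R d' d g)
    (n : nat) (X : mxtuple R g n) : 'M[Cplx R]_(d' * n, d * n) :=
  \sum_j L j *t X j.

Definition nondegenerate_pencil (R : realType) (d' d g : nat) (L : pencil R d' d g) :=
  forall (n : nat) (X : mxtuple R g n), pencil_eval L X = 0 -> X = 0.

Definition pball (R : realType) (d' d g : nat) (L : pencil R d' d g) (n : nat)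
    : set (mxtuple R g n) :=
  [set X | opnorm (pencil_eval L X) < 1].
Arguments pball {R d' d g} L n.

Definition pball_boundary (R : realType) (d' d g : nat) (L : pencil R d' d g)
    (n : nat) : set (mxtuple R g n) :=
  [set X | opnorm (pencil_eval L X) = 1].
Arguments pball_boundary {R d' d g} L n.

Definition same_pball (R : realType) (d1' d1 d2' d2 g : nat)
    (L1 : pencil R d1' d1 g) (L2 : pencil R d2' d2 g) :=
  forall n : nat, pball L1 n = pball L2 n.

Definition minimal_defining_pencil (R : realType) (p' p g : nat)
    (Lt : pencil R p' p g) :=
  nondegenerate_pencil Lt /\
  forall (d' d : nat) (L : pencil R d' d g),
    nondegenerate_pencil L -> same_pball L Lt -> (p' * p <= d' * d)%N.

Definition minimal_defining_pencil_for (R : realType) (d' d p' p g : nat)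
    (L : pencil R d' d g) (Lt : pencil R p' p g) :=
  minimal_defining_pencil Lt /\ same_pball Lt L.

(* Words are sequences of letters in 'I_g; [f w] is the coefficient of w. *)
Definition fps (R : realType) (l' l g : nat) :=
  seq 'I_g -> 'M[Cplx R]_(l', l).

Definition word_eval (R : realType) (g n : nat) (X : mxtuple R g n)
    (w : seq 'I_g) : 'M[Cplx R]_n :=
  \prod_(j <- w) X j.

Definition fps_homog_eval (R : realType) (l' l g : nat) (f : fps R l' l g)
    (n : nat) (X : mxtuple R g n) (k : nat) : 'M[Cplx R]_(l' * n, l * n) :=
  \sum_(w : k.-tuple 'I_g) f w *t word_eval X w.

(* [limn] is a junk value when the series diverges. *)
Definition fps_eval (R : realType) (l' l g : nat) (f : fps R l' l g)
    (n : nat) (X : mxtuple R g n) : 'M[Cplx R]_(l' * n, l * n) :=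
  limn (series (fps_homog_eval f X)).

Definition analytic_on_pball (R : realType) (d' d g l' l : nat)
    (L : pencil R d' d g) (f : fps R l' l g) :=
  forall (n : nat) (X : mxtuple R g n),
    pball L n X -> cvgn (series (fps_homog_eval f X)).

Definition contraction_valued (R : realType) (d' d g l' l : nat)
    (L : pencil R d' d g) (f : fps R l' l g) :=
  forall (n : nat) (X : mxtuple R g n),
    pball L n X -> opnorm (fps_eval f X) <= 1.

Definition expi (R : realType) (t : R) : Cplx R := cos t +i* sin t.

(* [B] is the radial boundary value at exp(it) of z |-> f(zX). *)
Definition boundary_value (R : realType) (l' l g : nat) (f : fps R l' l g)
    (n : nat) (X : mxtuple R g n) (t : R) (B : 'M[Cplx R]_(l' * n, l * n)) :=
  fps_eval f ((r%:C * expi t : Cplx R) *: X) @[r --> (1 : R)^'-] --> B.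

Definition pencil_ball_map (R : realType) (d' d g l' l : nat)
    (L : pencil R d' d g) (f : fps R l' l g) :=
  [/\ analytic_on_pball L f,
      contraction_valued L f &
      forall (n : nat) (X : mxtuple R g n), pball_boundary L n X ->
        {ae @lebesgue_measure R, forall t : R,
          exists2 B, boundary_value f X t B & opnorm B = 1}].

Definition pencil_fps (R : realType) (d' d g : nat) (L : pencil R d' d g)
    : fps R d' d g :=
  fun w => if w is [:: j] then L j else 0.

(* Main.v *)
Require Import Defs.
From HB Require Import structures.
From mathcomp Require Import all_boot all_order all_algebra.
From mathcomp Require Import all_classical all_reals all_analysis.
From mathcomp.real_closed Require Import complex.
From mathcomp.real_closed Require mxtens.
From mathcomp Require Import ring lra zify.

(* The linear part M of f satisfies ||M(X)|| = ||L(X)|| for every X: the tuple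
   E_12 (x) X is nilpotent of order 2, so f is linear on the disc it spans, and
   the boundary condition applies to that linear map.

   Main step: every pencil M with the same norms as a minimal pencil Lt contains
   Lt as a direct summand, up to isometries.  Take a common direct summand K of
   Lt and M of largest size.  If ||K(X)|| < ||Lt(X)|| for some X, then near X the
   norms of the complements of K in Lt and in M agree.  Comparing directional
   derivatives of these two norms gives a pair (u, v) of top singular vectors for
   one complement and (w, w') for the other which define the same linear
   functional; then u and w, as well as v and w', have the same Gram matrix.
   Choose X so that the smallest rank of u plus rank of v over such quadruples is
   as large as possible.  Bordering X by e times the coordinate inclusions and
   letting e tend to 0 cannot raise that rank, which forces the ranges of u and v
   (and of w and w') to be reducing, and K can be enlarged.  Hence K has the norms
   of Lt, and by minimality the size of Lt.

   Finally, evaluating f at nilpotent block bidiagonal tuples shows that stacking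
   a small multiple of the pencil of higher coefficients j |-> f_(sj) below the
   summand Lt, or of j |-> f_(js) beside it, does not change the norms.  The main
   step applied to this larger pencil gives an equality of Hilbert-Schmidt norms
   that leaves no room for the higher coefficients. *)

Set Implicit Arguments.
Unset Strict Implicit.
Unset Printing Implicit Defensive.

Import Order.TTheory GRing.Theory Num.Theory.
Import numFieldNormedType.Exports.

Local Open Scope classical_set_scope.
Local Open Scope ring_scope.
Local Open Scope sesquilinear_scope.

(** * Real inner product on complex matrices *)

(** The real part of the Hilbert-Schmidt inner product; derivatives of norms along a real parameter
    are expressed by it. *)
HB.lock Definition rdot (R : realType) (m n : nat) (u v : 'M[Cplx R]_(m, n)) : R :=
  complex.Re (\tr (u^t* *m v)).

Section RealInnerProduct.
Variable R : realType.
Local Notation C := (Cplx R).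

Definition rc (a : R) : C := real_complex R a.

Lemma Re_conj (z : C) : complex.Re z^* = complex.Re z.
Proof. by case: z. Qed.

Lemma ReD (z w : C) : complex.Re (z + w) = complex.Re z + complex.Re w.
Proof. by case: z w => [a b] [c d]. Qed.

Lemma ReMrc a (z : C) : complex.Re (rc a * z) = a * complex.Re z.
Proof. by case: z => [x y]; rewrite /= mul0r subr0. Qed.

Lemma conj_rc a : (rc a)^* = rc a.
Proof. by rewrite /rc; apply/eqP; rewrite eq_complex /= oppr0 !eqxx. Qed.

Lemma rcM a b : rc (a * b) = rc a * rc b.
Proof. exact: rmorphM. Qed.

Section Fixed.
Variables m n : nat.
Implicit Types u v w : 'M[C]_(m, n).

Lemma adjD u v : (u + v)^t* = u^t* + v^t*.
Proof. by rewrite linearD /= map_mxD. Qed.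

Lemma adjZ (a : C) u : (a *: u)^t* = a^* *: u^t*.
Proof. by rewrite linearZ /= map_mxZ. Qed.

Lemma adj_mul p (u : 'M[C]_(m, n)) (v : 'M[C]_(n, p)) :
  (u *m v)^t* = v^t* *m u^t*.
Proof. by rewrite trmx_mul map_mxM. Qed.

Lemma rdotE u v :
  rdot u v = \sum_i \sum_j complex.Re ((u i j)^* * v i j).
Proof.
rewrite rdot.unlock /mxtrace exchange_big /= (big_morph _ ReD (erefl _)).
apply: eq_bigr => j _; rewrite mxE (big_morph _ ReD (erefl _)).
by apply: eq_bigr => i _; rewrite !mxE.
Qed.

Lemma rdotC u v : rdot u v = rdot v u.
Proof.
rewrite !rdotE; apply: eq_bigr => i _; apply: eq_bigr => j _.
by rewrite -[RHS]Re_conj rmorphM /= conjCK mulrC.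
Qed.

Lemma rdotDr u v w : rdot u (v + w) = rdot u v + rdot u w.
Proof. by rewrite rdot.unlock mulmxDr mxtraceD ReD. Qed.

Lemma rdotDl u v w : rdot (v + w) u = rdot v u + rdot w u.
Proof. by rewrite !(rdotC _ u) rdotDr. Qed.

Lemma rdotZr a u v : rdot u (rc a *: v) = a * rdot u v.
Proof. by rewrite rdot.unlock -scalemxAr mxtraceZ ReMrc. Qed.

Lemma rdotZl a u v : rdot (rc a *: u) v = a * rdot u v.
Proof. by rewrite rdotC rdotZr rdotC. Qed.

Lemma rdot0r u : rdot u 0 = 0.
Proof. by rewrite rdot.unlock mulmx0 mxtrace0. Qed.

Lemma rdotNr u v : rdot u (- v) = - rdot u v.
Proof. by apply: (addrI (rdot u v)); rewrite -rdotDr !subrr rdot0r. Qed.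

Lemma rdotNl u v : rdot (- u) v = - rdot u v.
Proof. by rewrite rdotC rdotNr rdotC. Qed.

Lemma rdot_sumr (I : Type) (r : seq I) (P : pred I) u (F : I -> 'M[C]_(m, n)) :
  rdot u (\sum_(i <- r | P i) F i) = \sum_(i <- r | P i) rdot u (F i).
Proof. by apply: big_morph => [v w|]; [apply: rdotDr|apply: rdot0r]. Qed.

Lemma rdot_suml (I : Type) (r : seq I) (P : pred I) u (F : I -> 'M[C]_(m, n)) :
  rdot (\sum_(i <- r | P i) F i) u = \sum_(i <- r | P i) rdot (F i) u.
Proof. by rewrite rdotC rdot_sumr; apply: eq_bigr => i _; rewrite rdotC. Qed.

Definition n2 u : R := rdot u u.

Lemma n2E u : n2 u = \sum_i \sum_j ComplexField.Normc.normc (u i j) ^+ 2.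
Proof.
rewrite /n2 rdotE; apply: eq_bigr => i _; apply: eq_bigr => j _.
case: (u i j) => [a b] /=; rewrite sqr_sqrtr ?addr_ge0 ?sqr_ge0 //.
by rewrite mulNr opprK !expr2.
Qed.

Lemma n2_ge0 u : 0 <= n2 u.
Proof.
by rewrite n2E; apply: sumr_ge0 => i _; apply: sumr_ge0 => j _; apply: sqr_ge0.
Qed.

Lemma n2_eq0 u : n2 u = 0 -> u = 0.
Proof.
move/eqP; rewrite n2E psumr_eq0 => [/allP h|i _]; last first.
  by apply: sumr_ge0 => j _; apply: sqr_ge0.
apply/matrixP => i j; rewrite mxE.
have := h i (mem_index_enum _); rewrite /= psumr_eq0 => [/allP /(_ j)|k _]; last first.
  exact: sqr_ge0.
rewrite mem_index_enum /= sqrf_eq0 => /(_ isT) /eqP.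
exact: ComplexField.Normc.eq0_normc.
Qed.

Lemma n20 : n2 0 = 0. Proof. exact: rdot0r. Qed.

Lemma n2Z a u : n2 (rc a *: u) = a ^+ 2 * n2 u.
Proof. by rewrite /n2 rdotZl rdotZr expr2 mulrA. Qed.

Lemma n2N u : n2 (- u) = n2 u.
Proof. by rewrite /n2 rdotNr rdotNl opprK. Qed.

Lemma n2D u v : n2 (u + v) = n2 u + 2 * rdot u v + n2 v.
Proof.
by rewrite /n2 rdotDl !rdotDr (rdotC v u) -!addrA mulr_natl mulr2n -!addrA.
Qed.

Lemma n2B u v : n2 (u - v) = n2 u - 2 * rdot u v + n2 v.
Proof. by rewrite n2D n2N rdotNr mulrN. Qed.

Lemma rdot_CS u v : rdot u v ^+ 2 <= n2 u * n2 v.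
Proof.
have [->|v0] := eqVneq v 0; first by rewrite rdot0r n20 mulr0 expr0n.
have nv : 0 < n2 v.
  rewrite lt_def n2_ge0 andbT; apply: contra_neq v0; exact: n2_eq0.
(* This vector is [n2 v] times the component of [u] orthogonal to [v]. *)
have := n2_ge0 (rc (n2 v) *: u - rc (rdot u v) *: v).
rewrite n2B !n2Z rdotZl rdotZr; move: nv.
generalize (n2 u) (n2 v) (rdot u v) => a b c b0 h.
by rewrite -(ler_pM2l b0); lra.
Qed.

Lemma rdot_le u v a b : 0 <= a -> 0 <= b -> n2 u <= a ^+ 2 -> n2 v <= b ^+ 2 ->
  rdot u v <= a * b.
Proof.
move=> a0 b0 ua vb; rewrite (le_trans (ler_norm _)) //.
rewrite -(@ler_pXn2r _ 2) ?nnegrE ?mulr_ge0 // real_normK ?num_real //.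
rewrite (le_trans (rdot_CS u v)) // exprMn ler_pM ?n2_ge0 //.
Qed.

End Fixed.

Lemma adj_adj m n (u : 'M[C]_(m, n)) : u^t*^t* = u.
Proof. exact: trmxCK. Qed.

Lemma adj0 m n : (0 : 'M[C]_(m, n))^t* = 0.
Proof. by rewrite trmx0 map_mx0. Qed.

Lemma adj_sum m n (I : Type) (r : seq I) (P : pred I) (F : I -> 'M[C]_(m, n)) :
  (\sum_(i <- r | P i) F i)^t* = \sum_(i <- r | P i) (F i)^t*.
Proof. exact: (big_morph (fun u : 'M[C]_(m, n) => u^t*) (@adjD m n) (@adj0 m n)). Qed.

Lemma adj1 n : (1%:M : 'M[C]_n)^t* = 1%:M.
Proof. by rewrite trmx1 map_mx1. Qed.

Lemma adjN m n (u : 'M[C]_(m, n)) : (- u)^t* = - u^t*.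
Proof. by rewrite linearN /= map_mxN. Qed.

Lemma adjB m n (u v : 'M[C]_(m, n)) : (u - v)^t* = u^t* - v^t*.
Proof. by rewrite adjD adjN. Qed.

Lemma adj_row m k1 k2 (u : 'M[C]_(m, k1)) (v : 'M[C]_(m, k2)) :
  (row_mx u v)^t* = col_mx (u^t*) (v^t*).
Proof. by rewrite tr_row_mx map_col_mx. Qed.

Lemma adj_col m1 m2 n (u : 'M[C]_(m1, n)) (v : 'M[C]_(m2, n)) :
  (col_mx u v)^t* = row_mx (u^t*) (v^t*).
Proof. by rewrite tr_col_mx map_row_mx. Qed.

Lemma adj_block m1 m2 k1 k2 (a : 'M[C]_(m1, k1)) (b : 'M[C]_(m1, k2))
    (c : 'M[C]_(m2, k1)) (d : 'M[C]_(m2, k2)) :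
  (block_mx a b c d)^t* = block_mx (a^t*) (c^t*) (b^t*) (d^t*).
Proof. by rewrite tr_block_mx map_block_mx. Qed.

Lemma rdot_mull m n p (A : 'M[C]_(m, n)) (u : 'M[C]_(n, p)) v :
  rdot (A *m u) v = rdot u (A^t* *m v).
Proof. by rewrite rdot.unlock adj_mul mulmxA. Qed.

Lemma rdot_mulr m n p (u : 'M[C]_(m, n)) (A : 'M[C]_(n, p)) v :
  rdot (u *m A) v = rdot u (v *m A^t*).
Proof. by rewrite rdot.unlock adj_mul -mulmxA mxtrace_mulC -mulmxA. Qed.

Lemma rdot_adj m n (u v : 'M[C]_(m, n)) : rdot (u^t*) (v^t*) = rdot u v.
Proof. by rewrite [RHS]rdotC rdot.unlock adj_adj mxtrace_mulC. Qed.

Lemma rdot_row m k1 k2 (u u' : 'M[C]_(m, k1)) (v v' : 'M[C]_(m, k2)) :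
  rdot (row_mx u v) (row_mx u' v') = rdot u u' + rdot v v'.
Proof.
rewrite !rdotE -big_split; apply: eq_bigr => i _ /=.
rewrite big_split_ord; congr (_ + _); apply: eq_bigr => j _.
  by rewrite !row_mxEl.
by rewrite !row_mxEr.
Qed.

Lemma rdot_col m1 m2 n (u u' : 'M[C]_(m1, n)) (v v' : 'M[C]_(m2, n)) :
  rdot (col_mx u v) (col_mx u' v') = rdot u u' + rdot v v'.
Proof. by rewrite -rdot_adj !adj_col rdot_row !rdot_adj. Qed.

Lemma n2_row m k1 k2 (u : 'M[C]_(m, k1)) (v : 'M[C]_(m, k2)) :
  n2 (row_mx u v) = n2 u + n2 v.
Proof. exact: rdot_row. Qed.

Lemma n2_col m1 m2 n (u : 'M[C]_(m1, n)) (v : 'M[C]_(m2, n)) :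
  n2 (col_mx u v) = n2 u + n2 v.
Proof. exact: rdot_col. Qed.

Lemma n2_isoml m n p (A : 'M[C]_(m, n)) (u : 'M[C]_(n, p)) :
  A^t* *m A = 1%:M -> n2 (A *m u) = n2 u.
Proof. by move=> h; rewrite /n2 rdot_mull mulmxA h mul1mx. Qed.

(** Pythagoras for the orthogonal projection [A *m A^t*] onto the range of the isometry [A]. *)
Lemma n2_proj m n p (A : 'M[C]_(m, n)) (u : 'M[C]_(m, p)) :
  A^t* *m A = 1%:M -> n2 u = n2 (A^t* *m u) + n2 (u - A *m (A^t* *m u)).
Proof.
move=> h; rewrite n2B (n2_isoml _ h) (rdotC u) rdot_mull -/(n2 _).
by rewrite mulr_natl mulr2n; generalize (n2 (A^t* *m u)) (n2 u) => a b; lra.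
Qed.

Lemma n2_coisom m n p (A : 'M[C]_(m, n)) (u : 'M[C]_(m, p)) :
  A^t* *m A = 1%:M -> n2 (A^t* *m u) <= n2 u.
Proof. by move=> h; rewrite [leRHS](n2_proj _ h) lerDl n2_ge0. Qed.

Lemma n2Zc m n (z : C) (u : 'M[C]_(m, n)) :
  n2 (z *: u) = ComplexField.Normc.normc z ^+ 2 * n2 u.
Proof.
rewrite !n2E mulr_sumr; apply: eq_bigr => i _; rewrite mulr_sumr.
by apply: eq_bigr => j _; rewrite mxE ComplexField.Normc.normcM exprMn.
Qed.

Lemma n2_rows m n (B : 'M[C]_(m, n)) : n2 B = \sum_i n2 (row i B).
Proof.
rewrite n2E; apply: eq_bigr => i _; rewrite n2E big_ord1.
by apply: eq_bigr => j _; rewrite mxE.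
Qed.

Lemma n2_cols m n (B : 'M[C]_(m, n)) : n2 B = \sum_j n2 (col j B).
Proof.
rewrite n2E exchange_big; apply: eq_bigr => i _; rewrite n2E.
by apply: eq_bigr => j _; rewrite big_ord1 mxE.
Qed.

Lemma n2_mulmx m n p (A : 'M[C]_(m, n)) (u : 'M[C]_(n, p)) :
  n2 (A *m u) <= n2 A * n2 u.
Proof.
(* The complex Cauchy-Schwarz inequality from the real one: pairing [b] with [a^t* *m (a *m b)]
   removes the phase of the scalar [a *m b]. *)
have entry (a : 'rV[C]_n) (b : 'cV[C]_n) : n2 (a *m b) <= n2 a * n2 b.
  have [->|zn0] := eqVneq (n2 (a *m b)) 0; first by rewrite mulr_ge0 ?n2_ge0.
  have zgt : 0 < n2 (a *m b) by rewrite lt_def zn0 n2_ge0.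
  have zE : n2 (a *m b) = ComplexField.Normc.normc ((a *m b) 0 0) ^+ 2.
    by rewrite n2E !big_ord1.
  have nz : n2 (a^t* *m (a *m b)) = n2 (a *m b) * n2 a.
    rewrite zE {1}[a *m b]mx11_scalar mul_mx_scalar n2Zc; congr (_ * _).
    exact: rdot_adj.
  have := rdot_CS b (a^t* *m (a *m b)).
  rewrite -rdot_mull nz -/(n2 (a *m b)) expr2 mulrCA ler_pM2l //.
  by rewrite mulrC.
rewrite (n2_rows A) (n2_rows (A *m u)) mulr_suml; apply: ler_sum => i _.
rewrite (n2_cols u) (n2_cols (row i _)) mulr_sumr; apply: ler_sum => j _.
by rewrite colE row_mul -mulmxA -colE entry.
Qed.

End RealInnerProduct.


(** * Operator norms *)

Section Opnorm.
Variable R : realType.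
Local Notation C := (Cplx R).

Lemma l2normE n (v : 'cV[C]_n) : l2norm v = Num.sqrt (n2 v).
Proof.
rewrite /l2norm n2E; congr (Num.sqrt _).
by apply: eq_bigr => i _; rewrite big_ord1.
Qed.

Lemma l2norm_le n (v : 'cV[C]_n) c : 0 <= c -> (l2norm v <= c) = (n2 v <= c ^+ 2).
Proof.
move=> c0; rewrite l2normE -{1}(ger0_norm c0) -sqrtr_sqr ler_sqrt //.
exact: sqr_ge0.
Qed.

(** Makes the [sup] in [opnorm] a true supremum; the Hilbert-Schmidt norm of [A] is an upper
    bound. *)
Lemma opnorm_has_sup m n (A : 'M[C]_(m, n)) :
  has_sup [set l2norm (A *m v) | v in [set v | l2norm v <= 1]].
Proof.
split.
  by exists (l2norm (A *m 0)), 0 => //=; rewrite l2norm_le ?n20 ?ler01 // expr1n ler01.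
exists (Num.sqrt (n2 A)) => _ [v /=] v1 <-.
rewrite l2norm_le ?sqrtr_ge0 // sqr_sqrtr ?n2_ge0 //.
rewrite (le_trans (n2_mulmx _ _)) // ler_piMr ?n2_ge0 //.
by move: v1; rewrite l2norm_le // expr1n.
Qed.

Lemma opnorm_ge0 m n (A : 'M[C]_(m, n)) : 0 <= opnorm A.
Proof.
have := sup_upper_bound (opnorm_has_sup A) => /(_ (l2norm (A *m 0))) h.
apply: le_trans (h _); first by rewrite l2normE sqrtr_ge0.
by exists 0 => //=; rewrite l2norm_le ?n20 ?ler01 // expr1n ler01.
Qed.

Lemma n2_gt0 m n (v : 'M[C]_(m, n)) : v != 0 -> 0 < n2 v.
Proof.
by move=> v0; rewrite lt_def n2_ge0 andbT; apply: contra_neq v0; apply: n2_eq0.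
Qed.

Lemma unit_scale m n (v : 'M[C]_(m, n)) : v != 0 ->
  n2 (rc (Num.sqrt (n2 v))^-1 *: v) = 1.
Proof.
move=> v0; rewrite n2Z exprVn sqr_sqrtr ?n2_ge0 // mulVf //.
by rewrite gt_eqF ?n2_gt0.
Qed.

Lemma opnorm_ub m n (A : 'M[C]_(m, n)) (v : 'cV[C]_n) :
  n2 (A *m v) <= opnorm A ^+ 2 * n2 v.
Proof.
have [->|v0] := eqVneq v 0; first by rewrite mulmx0 !n20 mulr0.
have := sup_upper_bound (opnorm_has_sup A).
move=> /(_ (l2norm (A *m (rc (Num.sqrt (n2 v))^-1 *: v)))) h.
have {}h := h _; have: l2norm (A *m (rc (Num.sqrt (n2 v))^-1 *: v)) <= opnorm A.
  apply: h; exists (rc (Num.sqrt (n2 v))^-1 *: v) => //=.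
  by rewrite l2norm_le ?ler01 // unit_scale // expr1n.
rewrite l2norm_le ?opnorm_ge0 // -scalemxAr n2Z exprVn sqr_sqrtr ?n2_ge0 //.
by rewrite ler_pdivrMl ?n2_gt0 // mulrC.
Qed.

Lemma opnorm_le m n (A : 'M[C]_(m, n)) c : 0 <= c ->
  (forall v : 'cV[C]_n, n2 (A *m v) <= c ^+ 2 * n2 v) -> opnorm A <= c.
Proof.
move=> c0 h; apply: sup_le_ub; first by case: (opnorm_has_sup A).
move=> _ [v /= v1 <-]; rewrite l2norm_le // (le_trans (h v)) //.
rewrite ler_piMr ?sqr_ge0 //; move: v1; by rewrite l2norm_le ?ler01 // expr1n.
Qed.

End Opnorm.

(* With C^p (x) C^n identified with the p x n matrices, the pencil at X acts by
   u |-> sum_j L_j u X_j^T; [nrm] and [act] take the transposed tuple. *)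
HB.lock Definition nrm (R : realType) p' p g n (L : 'I_g -> 'M[Cplx R]_(p', p))
  (X : 'I_g -> 'M[Cplx R]_n) : R := opnorm (\sum_j mxtens.tensmx (L j) (X j)^T).

(** * Vectorisation, and pencils as operators on matrices *)

Section Act.
Variable R : realType.
Local Notation C := (Cplx R).
Local Notation "A *t B" := (mxtens.tensmx A B) (at level 40, left associativity).

(** Vectorisation in the index order of [tensmx], under which [A *t B] becomes
    [u |-> A *m u *m B^T]. *)
Definition cv m n (u : 'M[C]_(m, n)) : 'cV[C]_(m * n) :=
  \col_k u (mxtens.mxtens_unindex k).1 (mxtens.mxtens_unindex k).2.

Definition uncv m n (v : 'cV[C]_(m * n)) : 'M[C]_(m, n) :=
  \matrix_(i, j) v (mxtens.mxtens_index (i, j)) 0.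

Lemma cvK m n (u : 'M[C]_(m, n)) : uncv (cv u) = u.
Proof. by apply/matrixP => i j; rewrite !mxE mxtens.mxtens_indexK. Qed.

Lemma uncvK m n (v : 'cV[C]_(m * n)) : cv (uncv v) = v.
Proof.
apply/matrixP => i j; rewrite !mxE (ord1 j) -surjective_pairing.
by rewrite mxtens.mxtens_unindexK.
Qed.

Lemma sum_mxtens (V : nmodType) m n (F : 'I_(m * n) -> V) :
  \sum_k F k = \sum_i \sum_j F (mxtens.mxtens_index (i, j)).
Proof.
rewrite pair_bigA /= (reindex (@mxtens.mxtens_index m n)) /=.
  by apply: eq_bigr => -[].
exists (@mxtens.mxtens_unindex m n) => k _.
  exact: mxtens.mxtens_indexK.
exact: mxtens.mxtens_unindexK.
Qed.

Lemma n2_cv m n (u : 'M[C]_(m, n)) : n2 (cv u) = n2 u.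
Proof.
rewrite !n2E sum_mxtens; apply: eq_bigr => i _; apply: eq_bigr => j _.
by rewrite big_ord1 mxE mxtens.mxtens_indexK.
Qed.

Lemma cv_sum m n (I : Type) (r : seq I) (F : I -> 'M[C]_(m, n)) :
  cv (\sum_(i <- r) F i) = \sum_(i <- r) cv (F i).
Proof.
by apply/matrixP => i j; rewrite mxE !summxE; apply: eq_bigr => k _; rewrite mxE.
Qed.

Lemma tens_cv m' m n' n (A : 'M[C]_(m', m)) (B : 'M[C]_(n', n)) u :
  (A *t B) *m cv u = cv (A *m u *m B^T).
Proof.
apply/matrixP => k o; rewrite (ord1 o) {o}; case: (mxtens.mxtens_indexP k) => i j.
rewrite !mxE mxtens.mxtens_indexK /= sum_mxtens exchange_big /=.
apply: eq_bigr => b _; rewrite !mxE mulr_suml; apply: eq_bigr => a _.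
by rewrite mxtens.tensmxE !mxE mxtens.mxtens_indexK /= mulrAC.
Qed.

(** The [X j] may be rectangular, so that the off-diagonal blocks of a bordered tuple act by the
    same formula. *)
Definition act p' p g n' n (L : 'I_g -> 'M[C]_(p', p)) (X : 'I_g -> 'M[C]_(n', n))
  (u : 'M[C]_(p, n')) : 'M[C]_(p', n) := \sum_j L j *m u *m X j.

Lemma act_cv p' p g n (L : 'I_g -> 'M[C]_(p', p)) (X : 'I_g -> 'M[C]_n) u :
  (\sum_j L j *t (X j)^T) *m cv u = cv (act L X u).
Proof.
by rewrite mulmx_suml cv_sum; apply: eq_bigr => j _; rewrite tens_cv trmxK.
Qed.

Section Nrm.
Variables (p' p g n : nat).
Implicit Types (L : 'I_g -> 'M[C]_(p', p)) (X : 'I_g -> 'M[C]_n).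

Lemma nrm_ge0 L X : 0 <= nrm L X. Proof. rewrite nrm.unlock; exact: opnorm_ge0. Qed.

Lemma nrm_ub L X u : n2 (act L X u) <= nrm L X ^+ 2 * n2 u.
Proof.
rewrite nrm.unlock -(n2_cv u) -(n2_cv (act L X u)) -act_cv; exact: opnorm_ub.
Qed.

Lemma nrm_le L X c : 0 <= c ->
  (forall u, n2 (act L X u) <= c ^+ 2 * n2 u) -> nrm L X <= c.
Proof.
by rewrite nrm.unlock => c0 h; apply: opnorm_le => // v; rewrite -(uncvK v) act_cv !n2_cv.
Qed.

End Nrm.
End Act.


(** * Entrywise continuity and compactness *)

Section Continuity.
Variable R : realType.
Local Notation C := (Cplx R).

Lemma normC_rc (z : C) : `|z| = rc (ComplexField.Normc.normc z).
Proof. by case: z. Qed.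

Lemma rc_lt (a b : R) : (rc a < rc b) = (a < b).
Proof. by rewrite ltcE /= eqxx. Qed.

Lemma posC_rc (e : C) : 0 < e -> exists2 a : R, 0 < a & e = rc a.
Proof.
case: e => a b; rewrite ltcE /= => /andP[/eqP -> a0].
by exists a.
Qed.

Lemma rc_continuous : continuous (@rc R).
Proof.
move=> x A /= /(nbhs_ballP (rc x)) [e e0 eA].
have [a a0 ea] := posC_rc e0.
apply/nbhs_ballP; exists a => //= y; rewrite /ball /= => xy.
apply: eA; rewrite /ball /= ea -rmorphB normC_rc rc_lt.
by rewrite /= expr0n addr0 sqrtr_sqr.
Qed.

Lemma Re_le_norm (z : C) : `|complex.Re z| <= ComplexField.Normc.normc z.
Proof.
case: z => a b /=; rewrite -sqrtr_sqr ler_sqrt ?addr_ge0 ?sqr_ge0 //.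
by rewrite lerDl sqr_ge0.
Qed.

Lemma Im_le_norm (z : C) : `|complex.Im z| <= ComplexField.Normc.normc z.
Proof.
case: z => a b /=; rewrite -sqrtr_sqr ler_sqrt ?addr_ge0 ?sqr_ge0 //.
by rewrite lerDr sqr_ge0.
Qed.

Lemma Re_continuous : continuous (fun z : C => complex.Re z).
Proof.
move=> x A /= /(nbhs_ballP (complex.Re x)) [e e0 eA].
apply/nbhs_ballP; exists (rc e) => /=; first by rewrite rc_lt.
move=> y; rewrite /ball /= normC_rc rc_lt => xy.
apply: eA; rewrite /ball /=; apply: le_lt_trans xy.
by rewrite -[X in `|X|]/(complex.Re x - complex.Re y) (le_trans _ (Re_le_norm _)) //; case: x; case: y.
Qed.

Lemma conj_continuous : continuous (fun z : C => z^*).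
Proof.
move=> x A /= /(nbhs_ballP (x^*)) [e e0 eA].
apply/nbhs_ballP; exists e => //= y; rewrite /ball /= => xy.
by apply: eA; rewrite /ball /= -rmorphB norm_conjC.
Qed.

(** Continuity is handled entry by entry, which reduces products, adjoints and block operations to
    scalar maps. *)
Definition mcont (T : topologicalType) m n (F : T -> 'M[C]_(m, n)) :=
  forall i j, continuous (fun t => F t i j : C).

Section Kit.
Variable T : topologicalType.

Lemma cst_cont (V : topologicalType) (c : V) : continuous (fun _ : T => c).
Proof. by move=> x; apply: cvg_cst. Qed.

Lemma mcont_proj m n (F : T -> 'M[C]_(m, n)) : continuous F -> mcont F.
Proof.
move=> cF i j x; apply: (@continuous_comp _ _ _ F (fun M => M i j)).
  exact: cF.
exact: coord_continuous.
Qed.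

Lemma mcont_cst m n (A : 'M[C]_(m, n)) : mcont (fun _ : T => A).
Proof. by move=> i j; apply: cst_cont. Qed.

Lemma continuous_sum (V : normedModType C) (I : Type) (r : seq I) (F : I -> T -> V) :
  (forall i, continuous (F i)) -> continuous (fun t => \sum_(i <- r) F i t).
Proof.
move=> cF; elim: r => [|i r ih].
  by under eq_fun do rewrite big_nil; apply: cst_cont.
under eq_fun do rewrite big_cons.
by move=> x; apply: cvgD; [apply: cF|apply: ih].
Qed.

Lemma continuous_prod (I : Type) (r : seq I) (F : I -> T -> C) :
  (forall i, continuous (F i)) -> continuous (fun t => \prod_(i <- r) F i t : C).
Proof.
move=> cF; elim: r => [|i r ih].
  by under eq_fun do rewrite big_nil; apply: cst_cont.
under eq_fun do rewrite big_cons.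
by move=> x; apply: cvgM; [apply: cF|apply: ih].
Qed.

Lemma continuous_sumR (I : Type) (r : seq I) (F : I -> T -> R) :
  (forall i, continuous (F i)) -> continuous (fun t => \sum_(i <- r) F i t).
Proof.
move=> cF; elim: r => [|i r ih].
  by under eq_fun do rewrite big_nil; apply: cst_cont.
under eq_fun do rewrite big_cons.
by move=> x; apply: cvgD; [apply: cF|apply: ih].
Qed.

Lemma mcontD m n (F G : T -> 'M[C]_(m, n)) :
  mcont F -> mcont G -> mcont (fun t => F t + G t).
Proof.
move=> cF cG i j; under eq_fun do rewrite mxE.
by move=> x; apply: cvgD; [apply: cF|apply: cG].
Qed.

Lemma mcont_sum m n (I : Type) (r : seq I) (F : I -> T -> 'M[C]_(m, n)) :
  (forall i, mcont (F i)) -> mcont (fun t => \sum_(i <- r) F i t).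
Proof.
move=> cF i j; under eq_fun do rewrite summxE.
by apply: (@continuous_sum C) => k; apply: cF.
Qed.

Lemma mcontM m n p (F : T -> 'M[C]_(m, n)) (G : T -> 'M[C]_(n, p)) :
  mcont F -> mcont G -> mcont (fun t => F t *m G t).
Proof.
move=> cF cG i j; under eq_fun do rewrite mxE.
apply: (@continuous_sum C) => k x.
by apply: cvgM; [apply: cF|apply: cG].
Qed.

Lemma mcontZ m n (f : T -> R) (G : T -> 'M[C]_(m, n)) :
  continuous f -> mcont G -> mcont (fun t => rc (f t) *: G t).
Proof.
move=> cf cG i j; under eq_fun do rewrite mxE.
move=> x; apply: cvgM; last exact: cG.
by apply: (@continuous_comp _ _ _ f (@rc R) x); [apply: cf|apply: rc_continuous].
Qed.

Lemma mcont_adj m n (F : T -> 'M[C]_(m, n)) : mcont F -> mcont (fun t => (F t)^t*).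
Proof.
move=> cF i j; under eq_fun do rewrite !mxE.
move=> x; by apply: (@continuous_comp _ _ _ (fun t => F t j i) _ x); [apply: cF|apply: conj_continuous].
Qed.

Lemma mcont_row m k1 k2 (F : T -> 'M[C]_(m, k1)) (G : T -> 'M[C]_(m, k2)) :
  mcont F -> mcont G -> mcont (fun t => row_mx (F t) (G t)).
Proof.
move=> cF cG i j; case: (split_ordP j) => k ->.
  by under eq_fun do rewrite row_mxEl; apply: cF.
by under eq_fun do rewrite row_mxEr; apply: cG.
Qed.

Lemma mcont_col m1 m2 n (F : T -> 'M[C]_(m1, n)) (G : T -> 'M[C]_(m2, n)) :
  mcont F -> mcont G -> mcont (fun t => col_mx (F t) (G t)).
Proof.
move=> cF cG i j; case: (split_ordP i) => k ->.
  by under eq_fun do rewrite col_mxEu; apply: cF.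
by under eq_fun do rewrite col_mxEd; apply: cG.
Qed.

Lemma mcont_block m1 m2 k1 k2 (A : T -> 'M[C]_(m1, k1)) (B : T -> 'M[C]_(m1, k2))
    (D : T -> 'M[C]_(m2, k1)) (E : T -> 'M[C]_(m2, k2)) :
  mcont A -> mcont B -> mcont D -> mcont E ->
  mcont (fun t => block_mx (A t) (B t) (D t) (E t)).
Proof. by move=> *; apply: mcont_col; apply: mcont_row. Qed.

Lemma mcont_lsub m k1 k2 (F : T -> 'M[C]_(m, k1 + k2)) :
  mcont F -> mcont (fun t => lsubmx (F t)).
Proof. by move=> cF i j; under eq_fun do rewrite mxE; apply: cF. Qed.

Lemma mcont_rdot m n (F G : T -> 'M[C]_(m, n)) :
  mcont F -> mcont G -> continuous (fun t => rdot (F t) (G t)).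
Proof.
move=> cF cG; under eq_fun do rewrite rdot.unlock.
move=> x.
apply: (@continuous_comp _ _ _ (fun t => \tr ((F t)^t* *m G t) : C)
  (fun z : C => complex.Re z)); last exact: Re_continuous.
move: x; apply: (@continuous_sum C) => i; apply: mcontM => //; exact: mcont_adj.
Qed.

Lemma continuous_det n (F : T -> 'M[C]_n) : mcont F -> continuous (fun t => \det (F t) : C).
Proof.
move=> cF; apply: (@continuous_sum C) => s x.
apply: cvgM; first exact: cvg_cst.
by move: x; apply: continuous_prod => i; apply: cF.
Qed.

Lemma closed_and (P Q : T -> Prop) :
  closed [set t | P t] -> closed [set t | Q t] -> closed [set t | P t /\ Q t].
Proof. exact: closedI. Qed.

Lemma closed_all I (P : I -> T -> Prop) :
  (forall i, closed [set t | P i t]) -> closed [set t | forall i, P i t].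
Proof.
move=> cP.
have -> : [set t | forall i, P i t] = \bigcap_(i in setT) [set t | P i t].
  by rewrite predeqE => t; split=> h i => [_|]; [apply: h|apply: (h i Logic.I)].
by apply: closed_bigI => i _; apply: cP.
Qed.

Lemma closed_mxeq m n (F G : T -> 'M[C]_(m, n)) :
  mcont F -> mcont G -> closed [set t | F t = G t].
Proof.
move=> cF cG.
have -> : [set t | F t = G t] = [set t | forall i j, F t i j = G t i j].
  by rewrite predeqE => t; split=> [/= -> //|h]; apply/matrixP.
apply: closed_all => i; apply: closed_all => j.
have -> : [set t | F t i j = G t i j] = (fun t => F t i j - G t i j) @^-1` [set (0 : C)].
  by rewrite predeqE => t; split=> /= /eqP h; apply/eqP; rewrite ?subr_eq0 // -subr_eq0.
apply: preimage_closed.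
  by move=> x _; apply: cvgB; [apply: cF|apply: cG].
exact/accessible_closed_set1/hausdorff_accessible/norm_hausdorff.
Qed.

Lemma closed_ler (f h : T -> R) :
  continuous f -> continuous h -> closed [set t | f t <= h t].
Proof.
move=> cf ch.
have -> : [set t | f t <= h t] = (fun t => h t - f t) @^-1` [set x | 0 <= x].
  by rewrite predeqE => t /=; split; rewrite subr_ge0.
apply: preimage_closed; last exact: closed_ge.
by move=> x _; apply: cvgB; [apply: ch|apply: cf].
Qed.

Lemma closed_eqr (f h : T -> R) :
  continuous f -> continuous h -> closed [set t | f t = h t].
Proof.
move=> cf ch.
have -> : [set t | f t = h t] = [set t | f t <= h t /\ h t <= f t].
  by rewrite predeqE => t /=; split=> [->//|[a b]]; apply/eqP; rewrite eq_le a b.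
by apply: closed_and; apply: closed_ler.
Qed.

(** Rank at most [k] means that every compression [P *m F t *m Q] to size [k.+1] is singular, and
    determinants are continuous. *)
Lemma closed_rank m n (F : T -> 'M[C]_(m, n)) k :
  mcont F -> closed [set t | (\rank (F t) <= k)%N].
Proof.
move=> cF.
have -> : [set t | (\rank (F t) <= k)%N] = [set t |
    forall PQ : 'M[C]_(k.+1, m) * 'M[C]_(n, k.+1),
    (\det (PQ.1 *m F t *m PQ.2))%:M = 0 :> 'M[C]_1].
  rewrite predeqE => t; split=> /= h.
    move=> [P Q] /=; suff -> : \det (P *m F t *m Q) = 0 by rewrite raddf0.
    apply: contraTeq h; rewrite -unitfE -/(unitmx _) -ltnNge => /mxrank_unit rk.
    by rewrite -rk (leq_trans (mxrankM_maxl _ _)) ?mxrankM_maxr.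
  rewrite leqNgt; apply/negP => rk.
  (* The rank normal form of [F t] yields an invertible compression once the rank exceeds [k]. *)
  have [P [Q PQ]] : exists P Q, P *m F t *m Q = 1%:M :> 'M[C]_k.+1.
    exists (pid_mx k.+1 *m invmx (col_ebase (F t))), (invmx (row_ebase (F t)) *m pid_mx k.+1).
    rewrite -{2}(mulmx_ebase (F t)) -!mulmxA mulKmx ?col_ebase_unit //.
    rewrite (mulmxA (row_ebase _)) mulmxV ?row_ebase_unit // mul1mx.
    rewrite !mul_pid_mx -pid_mx_1; congr pid_mx.
    have := leq_trans rk (rank_leq_row _); have := leq_trans rk (rank_leq_col _); lia.
  have := h (P, Q); rewrite /= PQ det1 => /matrixP /(_ 0 0); rewrite !mxE eqxx mulr1n.
  by move/eqP; rewrite oner_eq0.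
apply: closed_all => PQ; apply: closed_mxeq; last exact: mcont_cst.
move=> i j; under eq_fun do rewrite mxE.
have -> : (i == j) by rewrite !ord1.
under eq_fun do rewrite mulr1n.
apply: continuous_det; apply: mcontM; last exact: mcont_cst.
by apply: mcontM => //; exact: mcont_cst.
Qed.

End Kit.

(** A box, compact as a product of squares, that contains the unit Hilbert-Schmidt ball; sets of
    unit vectors are closed subsets of it. *)
Definition mball m n : set 'M[C]_(m, n) :=
  [set u | forall i j, `|complex.Re (u i j)| <= 1 /\ `|complex.Im (u i j)| <= 1].

Lemma square_compact :
  compact [set z : C | `|complex.Re z| <= 1 /\ `|complex.Im z| <= 1].
Proof.
have -> : [set z : C | `|complex.Re z| <= 1 /\ `|complex.Im z| <= 1] =
    (fun ab : R * R => rc ab.1 + 'i * rc ab.2) @` (`[-1, 1] `*` `[-1, 1]).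
  rewrite predeqE => z; split=> [[h1 h2]|[[a b] /= []]].
    exists (complex.Re z, complex.Im z) => /=.
      by rewrite !in_itv /= -!ler_norml.
    case: z h1 h2 => a b _ _ /=.
    by apply/eqP; rewrite eq_complex /= !(mul0r, mul1r, mulr0, addr0, add0r, subr0) !eqxx.
  rewrite !in_itv /= -!ler_norml => h1 h2 <-.
  by rewrite /= !(mul0r, mul1r, mulr0, addr0, add0r, subr0).
apply: continuous_compact; last by apply: compact_setX; apply: segment_compact.
apply: continuous_subspaceT => x; apply: cvgD.
  by apply: (@continuous_comp _ _ _ fst (@rc R) x); [apply: cvg_fst|apply: rc_continuous].
apply: cvgM; first exact: cvg_cst.
by apply: (@continuous_comp _ _ _ snd (@rc R) x); [apply: cvg_snd|apply: rc_continuous].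
Qed.

Lemma mx_continuous (T : topologicalType) m n (F : T -> 'M[C]_(m, n)) :
  mcont F -> continuous F.
Proof.
move=> cF x A [P hP hPA].
rewrite nbhs_filterE /=.
have h : \forall t \near x, forall ij : 'I_m * 'I_n, P ij.1 ij.2 (F t ij.1 ij.2).
  apply: filter_forall => -[i j] /=; exact: (cF i j x _ (hP i j)).
apply: filterS h => t ht; apply: hPA => i j; exact: (ht (i, j)).
Qed.

Lemma mball_compact m n : compact (@mball m n).
Proof.
have -> : @mball m n = @vec_mx C m n @`
    [set v : 'rV[C]_(m * n) | forall i,
      [set z : C | `|complex.Re z| <= 1 /\ `|complex.Im z| <= 1] (v ord0 i)].
  rewrite predeqE => u; split=> [hu|[v hv <-] i j].
    exists (mxvec u); last exact: mxvecK.
    by move=> k /=; case/mxvec_indexP: k => i j; rewrite mxvecE; apply: hu.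
  by rewrite mxE; apply: (hv (mxvec_index i j)).
apply: continuous_compact; last exact: (@rV_compact C _ _ (fun=> square_compact)).
apply: continuous_subspaceT; apply: mx_continuous => i j.
under eq_fun do rewrite mxE.
exact: coord_continuous.
Qed.

Lemma n2_mball m n (u : 'M[C]_(m, n)) : n2 u <= 1 -> mball u.
Proof.
move=> u1 i j.
have h : ComplexField.Normc.normc (u i j) <= 1.
  rewrite -(@ler_pXn2r _ 2) ?nnegrE ?ler01 //; last first.
    by have := normr_ge0 (u i j); rewrite normC_rc lecE /= => /andP[].
  rewrite expr1n (le_trans _ u1) // n2E (bigD1 i) //= (bigD1 j) //= -addrA lerDl.
  rewrite addr_ge0 //; first by apply: sumr_ge0 => k _; exact: sqr_ge0.
  by apply: sumr_ge0 => k _; apply: sumr_ge0 => l _; exact: sqr_ge0.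
by split; [apply: le_trans (Re_le_norm _) h|apply: le_trans (Im_le_norm _) h].
Qed.

(* The projection of a compact set to the parameter axis is closed. *)
Lemma compact_param_limit (T : topologicalType) (K : set T) (D : set (R * T)) d :
  compact K -> closed D -> 0 < d ->
  (forall e, 0 < e < d -> exists2 t, K t & D (e, t)) ->
  exists2 t, K t & D (0, t).
Proof.
move=> cK cD d0 h.
have cA : compact (fst @` ((`[0, d] `*` K) `&` D)).
  apply: continuous_compact.
    by apply: continuous_subspaceT => x; exact: cvg_fst.
  apply: compact_closedI => //.
  by apply: compact_setX => //; apply: segment_compact.
have /(_ 0) := compact_closed (@Rhausdorff R) cA.
case=> [B /nbhs_ballP [r /= r0 rB]|[a t] [[/= _ Kt] Dt] /= a0]; last first.
  by exists t => //; rewrite -a0.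
(* Below both the radius [r] of the neighbourhood and [d], so that [0] is seen to adhere to the
   projection. *)
pose e := Order.min r d / 2.
have e0 : 0 < e by rewrite divr_gt0 // lt_min r0.
have er : e < r.
  by rewrite /e ltr_pdivrMr // (@le_lt_trans _ _ r) ?ge_min ?lexx // ltr_pMr // ltr1n.
have ed : e < d.
  by rewrite /e ltr_pdivrMr // (@le_lt_trans _ _ d) ?ge_min ?lexx ?orbT // ltr_pMr // ltr1n.
have [t Kt Dt] := h e ltac:(by rewrite e0 ed).
exists e; split; last by apply: rB; rewrite /ball /= sub0r normrN gtr0_norm.
by exists (e, t) => //; split=> //; split=> //=; rewrite in_itv /= !ltW.
Qed.

End Continuity.

Lemma oneB2_le0 (R : realType) (x y : R) : 1 <= x -> y <= 1 -> 1 - 2 * x + y <= 0.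
Proof. lra. Qed.

Lemma add_pos_small (R : realType) (lam e a b : R) : e * b + e < lam -> 0 < e ->
  - (e * a) <= e * b -> 0 < lam + e * a.
Proof. lra. Qed.

(** * Matched singular vectors *)

Section Singular.
Variable R : realType.
Local Notation C := (Cplx R).

Definition adjf g m n (F : 'I_g -> 'M[C]_(m, n)) : 'I_g -> 'M[C]_(n, m) :=
  fun j => (F j)^t*.

(** The adjoint of [act L X] for [rdot], see [rdot_act]. *)
Definition coact p' p g n' n (L : 'I_g -> 'M[C]_(p', p))
  (X : 'I_g -> 'M[C]_(n', n)) (v : 'M[C]_(p', n)) : 'M[C]_(p, n') :=
  act (adjf L) (adjf X) v.

Definition shift g m n (X Y : 'I_g -> 'M[C]_(m, n)) (e : R) : 'I_g -> 'M[C]_(m, n) :=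
  fun j => X j + rc e *: Y j.

Lemma mcont_act (T : topologicalType) p' p g n' n (L : 'I_g -> 'M[C]_(p', p))
    (X : T -> 'I_g -> 'M[C]_(n', n)) (u : T -> 'M[C]_(p, n')) :
  (forall j, mcont (fun t => X t j)) -> mcont u -> mcont (fun t => act L (X t) (u t)).
Proof.
move=> cX cu; apply: mcont_sum => j; apply: mcontM => //.
by apply: mcontM => //; apply: mcont_cst.
Qed.

Section ActAlgebra.
Variables (p' p g n' n : nat).
Implicit Types (L : 'I_g -> 'M[C]_(p', p)) (X Y : 'I_g -> 'M[C]_(n', n)).

Lemma actZ L X a u : act L X (rc a *: u) = rc a *: act L X u.
Proof.
by rewrite /act scaler_sumr; apply: eq_bigr => j _; rewrite -scalemxAr -scalemxAl.
Qed.

Lemma act_shift L X Y e u : act L (shift X Y e) u = act L X u + rc e *: act L Y u.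
Proof.
rewrite /act scaler_sumr -big_split; apply: eq_bigr => j _.
by rewrite mulmxDr scalemxAr.
Qed.

Lemma rdot_act L X u v : rdot v (act L X u) = rdot (coact L X v) u.
Proof.
rewrite /act rdot_sumr /coact /act rdot_suml; apply: eq_bigr => j _.
by rewrite /adjf rdot_mulr rdot_mull !adj_adj mulmxA.
Qed.

End ActAlgebra.

Section Norm.
Variables (p' p g n : nat).
Implicit Types (L : 'I_g -> 'M[C]_(p', p)) (X Y : 'I_g -> 'M[C]_n).

Lemma act_rdot_le L X u v : n2 u = 1 -> n2 v = 1 -> rdot v (act L X u) <= nrm L X.
Proof.
move=> u1 v1; rewrite -[leRHS]mul1r; apply: rdot_le; rewrite ?nrm_ge0 //.
  by rewrite v1 expr1n.
by rewrite (le_trans (nrm_ub _ _ _)) // u1 mulr1.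
Qed.

(** The unit sphere is compact, and it is nonempty because the norm is positive. *)
Lemma nrm_attained L X : 0 < nrm L X ->
  exists2 u, n2 u = 1 & n2 (act L X u) = nrm L X ^+ 2.
Proof.
move=> pos.
pose K := @mball R p n `&` [set u | n2 u = 1].
have cK : compact K.
  apply: compact_closedI; first exact: mball_compact.
  apply: closed_eqr; last exact: cst_cont.
  by apply: mcont_rdot; apply: mcont_proj => x; apply: cvg_id.
have K0 : K !=set0.
  apply: contrapT => K0.
  suff : nrm L X <= 0 by rewrite leNgt pos.
  apply: nrm_le => // u; suff -> : u = 0.
    have -> : act L X 0 = 0.
      by rewrite /act big1 // => j _; rewrite mulmx0 mul0mx.
    by rewrite !n20 mulr0.
  apply: contrapT => /eqP u0; apply: K0; exists (rc (Num.sqrt (n2 u))^-1 *: u).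
  by split; [apply: n2_mball|]; rewrite /= unit_scale.
have cf : continuous (fun u : 'M[C]_(p, n) => n2 (act L X u)).
  have cu : mcont (fun u : 'M[C]_(p, n) => act L X u).
    apply: mcont_act => [j|]; first exact: mcont_cst.
    by apply: mcont_proj => x; apply: cvg_id.
  exact: mcont_rdot.
have [u] := compact_EVT_max K0 cK (continuous_subspaceT cf).
rewrite inE => -[_ /= u1] umax; exists u => //.
apply/eqP; rewrite eq_le; apply/andP; split.
  by rewrite -[leRHS]mulr1 -u1 nrm_ub.
rewrite -[leRHS]sqr_sqrtr ?n2_ge0 // ler_pXn2r ?nnegrE ?nrm_ge0 ?sqrtr_ge0 //.
apply: nrm_le => [|w]; first exact: sqrtr_ge0.
have [->|w0] := eqVneq w 0.
  have -> : act L X 0 = 0 by rewrite /act big1 // => j _; rewrite mulmx0 mul0mx.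
  by rewrite !n20 mulr0.
rewrite sqr_sqrtr ?n2_ge0 //.
have wK : K (rc (Num.sqrt (n2 w))^-1 *: w).
  by split; [apply: n2_mball|]; rewrite /= unit_scale.
have := umax _ (mem_set wK).
by rewrite actZ n2Z exprVn sqr_sqrtr ?n2_ge0 // ler_pdivrMl ?n2_gt0 // mulrC.
Qed.

(** Cauchy-Schwarz for [v] and the image of [coact L X v], followed by cancellation of
    [n2 (coact L X v)]. *)
Lemma coact_ub L X v : n2 (coact L X v) <= nrm L X ^+ 2 * n2 v.
Proof.
have [->|h0] := eqVneq (n2 (coact L X v)) 0; first by rewrite mulr_ge0 ?sqr_ge0 ?n2_ge0.
have hgt : 0 < n2 (coact L X v) by rewrite lt_def h0 n2_ge0.
have := rdot_CS v (act L X (coact L X v)); rewrite rdot_act -/(n2 _) => h.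
rewrite -(ler_pM2l hgt) -expr2 (le_trans h) //.
have k := ler_wpM2l (n2_ge0 v) (nrm_ub L X (coact L X v)).
rewrite (le_trans k) //; generalize (n2 v) (nrm L X) (n2 (coact L X v)) => a b c.
by lra.
Qed.

(* For [0 < k], [u] and [v] are singular vectors of singular value [k^-1]. *)
Definition sing L X (k : R) u v :=
  [/\ v = rc k *: act L X u, u = rc k *: coact L X v & n2 u = 1].

Lemma sing_n2 L X k u v : sing L X k u v -> n2 v = 1.
Proof.
by move=> [hv hu <-]; rewrite {1}/n2 {2}hv rdotZr rdot_act -rdotZl -hu.
Qed.

(** Equality in Cauchy-Schwarz: with [v] the normalised image of [u], the squared distance from [u]
    to the rescaled [coact L X v] expands to at most [1 - 2 + 1]. *)
Lemma top_sing L X u : 0 < nrm L X -> n2 u = 1 -> n2 (act L X u) = nrm L X ^+ 2 ->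
  sing L X (nrm L X)^-1 u (rc (nrm L X)^-1 *: act L X u).
Proof.
move=> pos u1 au; have nz : nrm L X != 0 by rewrite gt_eqF.
set v := _ *: act L X u.
have v1 : n2 v = 1 by rewrite n2Z au exprVn mulVf // expf_neq0.
split=> //; apply/eqP; rewrite -subr_eq0; apply/eqP/n2_eq0/eqP.
rewrite eq_le n2_ge0 andbT n2B n2Z u1 rdotZr (rdotC u) -rdot_act.
have -> : act L X u = rc (nrm L X) *: v by rewrite /v scalerA -rcM divff // scale1r.
rewrite rdotZr -/(n2 v) v1 mulr1 mulVf // mulr1.
have h : (nrm L X)^-1 ^+ 2 * n2 (coact L X v) <= 1.
  rewrite exprVn ler_pdivrMl ?exprn_gt0 // mulr1.
  by rewrite (le_trans (coact_ub _ _ _)) // v1 mulr1.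
lra.
Qed.

Lemma sing_exists L X : 0 < nrm L X -> exists u v, sing L X (nrm L X)^-1 u v.
Proof.
move=> pos; have [u u1 au] := nrm_attained pos.
exists u, (rc (nrm L X)^-1 *: act L X u); exact: top_sing.
Qed.

End Norm.

(** The one-sided derivative of a norm in direction [Y] is the largest [rdot v (act L Y u)] over top
    singular pairs. For small [e], a top singular pair of [M] at [shift X Y e] has slope at least
    that of [u], [v]; a limit as [e] tends to 0 is a top singular pair at [X]. *)
Lemma directional_sing p' p l' l g n (L : 'I_g -> 'M[C]_(p', p))
    (M : 'I_g -> 'M[C]_(l', l)) (X Y : 'I_g -> 'M[C]_n) d u v :
  0 < nrm L X -> nrm M X = nrm L X -> 0 < d ->
  (forall e, 0 < e < d -> nrm L (shift X Y e) <= nrm M (shift X Y e)) ->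
  sing L X (nrm L X)^-1 u v ->
  exists w w', sing M X (nrm L X)^-1 w w' /\
    rdot v (act L Y u) <= rdot w' (act M Y w).
Proof.
move=> pos MX d0 le suv; have v1 := sing_n2 suv; have [hv hu u1] := suv.
move: pos MX suv hv hu; move lamE : (nrm L X) => lam pos MX suv hv hu.
have nz : lam != 0 by rewrite gt_eqF.
move aE : (rdot v (act L Y u)) => a.
have vLu : rdot v (act L X u) = lam.
  have -> : act L X u = rc lam *: v by rewrite hv scalerA -rcM divff // scale1r.
  by rewrite rdotZr -/(n2 v) v1 mulr1.
(* At [e = 0] the last inequality reads [lam <= rdot w' (act M X w)], which forces a top singular
   pair. *)
pose D := [set t : R * ('M[C]_(l, n) * 'M[C]_(l', n)) |
  n2 t.2.1 = 1 /\ n2 t.2.2 = 1 /\ a <= rdot t.2.2 (act M Y t.2.1) /\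
  lam + t.1 * a <= rdot t.2.2 (act M X t.2.1) + t.1 * rdot t.2.2 (act M Y t.2.1)].
(* The second bound keeps [lam + e * a] positive, so that the norm of [M] at the shifted tuple is
   positive and attained. *)
pose d' := Order.min d (lam / (`|a| + 1)).
have a1 : 0 < `|a| + 1 by rewrite ltr_wpDl.
have d'0 : 0 < d' by rewrite lt_min d0 divr_gt0.
have cw : mcont (fun t : R * ('M[C]_(l, n) * 'M[C]_(l', n)) => t.2.1).
  apply: mcont_proj => x; apply: (@continuous_comp _ _ _ snd fst); [exact: cvg_snd|exact: cvg_fst].
have cw' : mcont (fun t : R * ('M[C]_(l, n) * 'M[C]_(l', n)) => t.2.2).
  apply: mcont_proj => x; apply: (@continuous_comp _ _ _ snd snd); exact: cvg_snd.
have ce : continuous (fun t : R * ('M[C]_(l, n) * 'M[C]_(l', n)) => t.1).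
  by move=> x; exact: cvg_fst.
have cact (Z : 'I_g -> 'M[C]_n) :
    mcont (fun t : R * ('M[C]_(l, n) * 'M[C]_(l', n)) => act M Z t.2.1).
  by apply: mcont_act => // j; exact: mcont_cst.
have cr Z := mcont_rdot cw' (cact Z).
have closedD : closed D.
  apply: closed_and; first exact: (closed_eqr (mcont_rdot cw cw) (@cst_cont _ R 1)).
  apply: closed_and; first exact: (closed_eqr (mcont_rdot cw' cw') (@cst_cont _ R 1)).
  apply: closed_and; first exact: (closed_ler (@cst_cont _ R a) (cr Y)).
  apply: closed_ler => x.
    by apply: cvgD; [exact: cvg_cst|apply: cvgM; [exact: ce|exact: cvg_cst]].
  by apply: cvgD; [exact: cr|apply: cvgM; [exact: ce|exact: cr]].
have cK := compact_setX (@mball_compact R l n) (@mball_compact R l' n).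
have [e /andP[e0]|[w w'] /= _] := compact_param_limit cK closedD d'0.
  rewrite lt_min => /andP[ed eb].
  have lamea : lam + e * a = rdot v (act L (shift X Y e) u).
    by rewrite act_shift rdotDr vLu rdotZr aE.
  have pos1 : 0 < lam + e * a.
    have : - (e * a) <= e * `|a| by rewrite -mulrN ler_wpM2l ?(ltW e0) // -normrN ler_norm.
    by move: eb; rewrite ltr_pdivlMr // mulrDr mulr1 => eb; exact: (add_pos_small eb e0).
  have lem : lam + e * a <= nrm M (shift X Y e).
    by rewrite lamea (le_trans (act_rdot_le _ _ u1 v1)) // le // e0.
  have mpos := lt_le_trans pos1 lem.
  have [w w1 aw] := nrm_attained mpos.
  pose w' := rc (nrm M (shift X Y e))^-1 *: act M (shift X Y e) w.
  have w'1 : n2 w' = 1.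
    by rewrite n2Z aw exprVn mulVf // expf_neq0 // gt_eqF.
  have w'w : rdot w' (act M (shift X Y e) w) = nrm M (shift X Y e).
    by rewrite rdotZl -/(n2 _) aw expr2 mulKf // gt_eqF.
  exists (w, w') => /=; first by split; apply: n2_mball; rewrite /= ?w1 ?w'1.
  have h := act_rdot_le M X w1 w'1.
  rewrite act_shift rdotDr rdotZr in w'w; rewrite MX in h.
  rewrite /D /=; split; first exact: w1.
  split; first exact: w'1.
  split; last by rewrite w'w.
  (* The value at [X] is at most [lam], so the excess over [lam] comes from the term in [e]. *)
  rewrite -(ler_pM2l e0); apply: (@le_trans _ _ (nrm M (shift X Y e) - lam)).
    by rewrite lerBrDl.
  by rewrite lerBlDl -[leLHS]w'w lerD2r.
rewrite /D /= => -[w1 [w'1 [aw]]]; rewrite !mul0r !addr0 => lamw.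
exists w, w'; split=> //.
have naw : n2 (act M X w) <= lam ^+ 2.
  by rewrite (le_trans (nrm_ub _ _ _)) // w1 mulr1 MX.
have w'E : w' = rc lam^-1 *: act M X w.
  apply/eqP; rewrite -subr_eq0; apply/eqP/n2_eq0/eqP; rewrite eq_le n2_ge0 andbT.
  rewrite n2B n2Z w'1 rdotZr.
  have h1 : 1 <= lam^-1 * rdot w' (act M X w) by rewrite ler_pdivlMl ?mulr1.
  have h2 : lam^-1 ^+ 2 * n2 (act M X w) <= 1.
    by rewrite exprVn ler_pdivrMl ?exprn_gt0 // mulr1.
  exact: oneB2_le0.
have ew : n2 (act M X w) = lam ^+ 2.
  have : n2 (rc lam *: w') = lam ^+ 2 by rewrite n2Z w'1 mulr1.
  by rewrite w'E scalerA -rcM divff // scale1r.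
by rewrite w'E -MX; apply: top_sing; rewrite ?MX // ew.
Qed.

(** By [rdot_coef] the tuple of these matrices represents the real-linear functional
    [Y |-> rdot v (act L (adjf Y) u)]. *)
Definition coef p' p n (A : 'M[C]_(p', p)) (u : 'M[C]_(p, n)) (v : 'M[C]_(p', n)) :=
  v^t* *m A *m u.

Lemma rdot_coef p' p g n (L : 'I_g -> 'M[C]_(p', p)) (Y : 'I_g -> 'M[C]_n) u v :
  rdot v (act L (adjf Y) u) = \sum_j rdot (Y j) (coef (L j) u v).
Proof.
rewrite /act rdot_sumr; apply: eq_bigr => j _.
by rewrite /adjf rdotC rdot_mulr adj_adj rdotC rdot_mull /coef mulmxA.
Qed.

Definition coef2 p' p g n (L : 'I_g -> 'M[C]_(p', p)) (u : 'M[C]_(p, n)) v : R :=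
  \sum_j n2 (coef (L j) u v).

(** Singular pairs for a fixed [k] form a compact set, on which [coef2] is continuous. *)
Lemma sing_max p' p g n (L : 'I_g -> 'M[C]_(p', p)) (X : 'I_g -> 'M[C]_n) k u0 v0 :
  sing L X k u0 v0 ->
  exists u v, sing L X k u v /\ forall u' v', sing L X k u' v' -> coef2 L u' v' <= coef2 L u v.
Proof.
move=> s0.
pose T := ('M[C]_(p, n) * 'M[C]_(p', n))%type.
have cu : mcont (fun t : T => t.1) by apply: mcont_proj => x; exact: cvg_fst.
have cv : mcont (fun t : T => t.2) by apply: mcont_proj => x; exact: cvg_snd.
have ck : continuous (fun t : T => k) by exact: cst_cont.
pose S := [set t : T | t.2 = rc k *: act L X t.1 /\ t.1 = rc k *: coact L X t.2 /\ n2 t.1 = 1].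
have cS : closed S.
  have ca := mcont_act (L := L) (fun j => @mcont_cst R T _ _ (X j)) cu.
  have cc := mcont_act (L := adjf L) (fun j => @mcont_cst R T _ _ (adjf X j)) cv.
  apply: closed_and; first exact: (closed_mxeq cv (mcontZ ck ca)).
  apply: closed_and; first exact: (closed_mxeq cu (mcontZ ck cc)).
  exact: (closed_eqr (mcont_rdot cu cu) (@cst_cont _ R 1)).
have SE u v : sing L X k u v <-> S (u, v).
  by split=> [[a b c]|[/= a [b c]]].
have Sball u v : sing L X k u v -> (@mball R p n `*` @mball R p' n) (u, v).
  move=> suv; have v1 := sing_n2 suv; case: suv => _ _ u1.
  by split; apply: n2_mball; rewrite /= ?u1 ?v1.
have cK := compact_closedI (compact_setX (@mball_compact R p n) (@mball_compact R p' n)) cS.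
have K0 : (@mball R p n `*` @mball R p' n) `&` S !=set0.
  by exists (u0, v0); split; [exact: Sball|apply/SE].
have cf : continuous (fun t : T => coef2 L t.1 t.2).
  apply: continuous_sumR => j.
  have cc : mcont (fun t : T => coef (L j) t.1 t.2).
    by apply: mcontM => //; apply: mcontM; [exact: mcont_adj|exact: mcont_cst].
  exact: (mcont_rdot cc cc).
have [[u v]] := compact_EVT_max K0 cK (continuous_subspaceT cf).
rewrite inE => -[_ /SE suv] umax; exists u, v; split; first exact: suv.
move=> u' v' s'.
apply: (umax (u', v')); rewrite inE; split; [exact: Sball|exact/SE].
Qed.

(** Derivatives are compared in the direction given by the functional of [u], [v] itself. The
    functional found for [M] pairs with it to at least its squared norm and is no longer than it, so
    the squared distance of the two is at most 0. *)
Lemma sing_matchW p' p l' l g n (L : 'I_g -> 'M[C]_(p', p))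
    (M : 'I_g -> 'M[C]_(l', l)) (X : 'I_g -> 'M[C]_n) u v :
  0 < nrm L X -> nrm M X = nrm L X ->
  (forall Y, exists2 d, 0 < d &
    forall e, 0 < e < d -> nrm L (shift X Y e) <= nrm M (shift X Y e)) ->
  sing L X (nrm L X)^-1 u v ->
  (forall w w', sing M X (nrm L X)^-1 w w' -> coef2 M w w' <= coef2 L u v) ->
  exists w w', sing M X (nrm L X)^-1 w w' /\
    forall j, coef (M j) w w' = coef (L j) u v.
Proof.
move=> pos MX le suv umax.
pose Y := fun j => coef (L j) u v.
have [d d0 led] := le (adjf Y).
have [w [w' [sww']]] := directional_sing pos MX d0 led suv.
rewrite !rdot_coef => h; exists w, w'; split=> // j.
have := umax _ _ sww'; rewrite /coef2 => h2.
have h3 : \sum_j n2 (coef (M j) w w' - coef (L j) u v) <= 0.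
  rewrite (eq_bigr (fun j => n2 (coef (M j) w w') + n2 (coef (L j) u v)
    - 2 * rdot (Y j) (coef (M j) w w'))); last first.
    by move=> i _; rewrite n2B rdotC addrAC.
  rewrite sumrB big_split /= -mulr_sumr subr_le0 mulr_natl mulr2n.
  apply: lerD; last exact: h.
  exact: le_trans h2 h.
apply/eqP; rewrite -subr_eq0; apply/eqP/n2_eq0/eqP; rewrite eq_le n2_ge0 andbT.
apply: le_trans h3; rewrite (bigD1 j) //= lerDl; apply: sumr_ge0 => i _; exact: n2_ge0.
Qed.

(* The pair of largest [coef2] on either side is matched on the other side. *)
Lemma sing_match p' p l' l g n (L : 'I_g -> 'M[C]_(p', p))
    (M : 'I_g -> 'M[C]_(l', l)) (X : 'I_g -> 'M[C]_n) :
  0 < nrm L X -> nrm M X = nrm L X ->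
  (forall Y, exists2 d, 0 < d &
    forall e, 0 < e < d -> nrm M (shift X Y e) = nrm L (shift X Y e)) ->
  exists u v w w', [/\ sing L X (nrm L X)^-1 u v, sing M X (nrm L X)^-1 w w' &
    forall j, coef (M j) w w' = coef (L j) u v].
Proof.
move=> pos MX le.
have [u0 [v0 s0]] := sing_exists pos.
have [u [v [suv umax]]] := sing_max s0.
have pos' : 0 < nrm M X by rewrite MX.
have [w0 [w0' t0]] := sing_exists pos'; rewrite MX in t0.
have [w [w' [sww' wmax]]] := sing_max t0.
have [lew|lew] := leP (coef2 M w w') (coef2 L u v).
  have [||w1 [w1' [h1 h2]]] := sing_matchW pos MX _ suv.
  - move=> Y; have [d d0 h] := le Y; exists d; first exact: d0.
  by move=> e /h hE; rewrite hE; exact: lexx.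
  - by move=> z z' sz; apply: le_trans (wmax _ _ sz) lew.
  by exists u, v, w1, w1'.
rewrite -MX in sww' umax.
have [||u1 [v1 [h1 h2]]] := sing_matchW pos' (esym MX) _ sww'.
- move=> Y; have [d d0 h] := le Y; exists d; first exact: d0.
  by move=> e /h hE; rewrite hE; exact: lexx.
- by move=> z z' sz; apply: le_trans (umax _ _ sz) (ltW lew).
rewrite MX in h1 sww'; exists u1, v1, w, w'; split; [exact: h1|exact: sww'|].
by move=> j; rewrite h2.
Qed.

End Singular.

(** * Direct summands *)

Section Summand.
Variable R : realType.
Local Notation C := (Cplx R).

Lemma n2_gram m n (u : 'M[C]_(m, n)) : u^t* *m u = 0 -> u = 0.
Proof.
move=> h; apply: n2_eq0; have := rdot_mull u 1%:M u.
by rewrite mulmx1 h rdot0r.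
Qed.

Lemma mxrank_adj m n (u : 'M[C]_(m, n)) : \rank (u^t*) = \rank u.
Proof. by rewrite mxrank_map mxrank_tr. Qed.

Lemma mxrank_gram m n (u : 'M[C]_(m, n)) : \rank (u^t* *m u) = \rank u.
Proof.
apply/eqP; rewrite eqn_leq mxrankM_maxr /=.
rewrite -[leqLHS](mxrank_adj u).
have : (kermx (u^t* *m u) <= kermx (u^t*))%MS.
  apply/sub_kermxP; set k := kermx _.
  have : k *m (u^t* *m u) = 0 by apply/sub_kermxP.
  rewrite mulmxA => h.
  have : ((k *m u^t*)^t*)^t* *m (k *m u^t*)^t* = 0.
    by rewrite adj_adj adj_mul adj_adj mulmxA h mul0mx.
  by move/n2_gram => h2; rewrite -[LHS]adj_adj h2 adj0.
move=> /mxrankS h.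
have h1 : (n - \rank (u^t* *m u) <= n - \rank (u^t*))%N.
  exact: leq_trans (eq_leq (esym (mxrank_ker _))) (leq_trans h (eq_leq (mxrank_ker _))).
have h2 : (\rank (u^t*) <= n)%N := rank_leq_row _.
rewrite leqNgt; apply/negP => ab.
by have := ltn_sub2l (leq_trans ab h2) ab; rewrite ltnNge h1.
Qed.

Lemma rank_row_sub m k1 k2 (a : 'M[C]_(m, k1)) (x : 'M[C]_(m, k2)) :
  (\rank (row_mx a x) <= \rank a)%N -> exists T, x = a *m T.
Proof.
move=> h; have s : (a^T <= (row_mx a x)^T)%MS.
  by rewrite tr_row_mx -addsmxE addsmxSl.
have /eqP e : \rank (a^T) == \rank ((row_mx a x)^T).
  by rewrite eqn_leq mxrankS //= !mxrank_tr.
have : (x^T <= a^T)%MS.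
  rewrite (submx_trans _ (_ : (row_mx a x)^T <= a^T)%MS) //.
    by rewrite tr_row_mx -addsmxE addsmxSr.
  by have /leqifP := mxrank_leqif_sup s; rewrite e ltnn; case: ifP.
by case/submxP => T xT; exists T^T; rewrite -[x]trmxK xT trmx_mul trmxK.
Qed.

Lemma rank_row_scale m k1 k2 (a : 'M[C]_(m, k1)) (x : 'M[C]_(m, k2)) s : s != 0 ->
  (\rank (row_mx a x) <= \rank (row_mx a (rc s *: x)))%N.
Proof.
move=> s0; have -> : row_mx a x =
    row_mx a (rc s *: x) *m block_mx 1%:M 0 0 (rc s^-1)%:M.
  rewrite mul_row_block !mulmx0 addr0 add0r mulmx1 mul_mx_scalar scalerA -rcM.
  by rewrite mulVf // scale1r.
exact: mxrankM_maxl.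
Qed.

(** Gram-Schmidt on a basis of the column space gives [B]; [h] has a right inverse because its rank
    is all of [\rank u]. *)
Lemma isom_factor p n (u : 'M[C]_(p, n)) :
  exists r (B : 'M[C]_(p, r)) (h : 'M[C]_(r, n)) (h' : 'M[C]_(n, r)),
    [/\ B^t* *m B = 1%:M, u = B *m h & h *m h' = 1%:M].
Proof.
exists (\rank u).
pose S := schmidt ((col_base u)^t*).
have rp := rank_leq_row u.
have SU : S *m S^t* = 1%:M by apply/unitarymxP/schmidt_unitarymx.
have /submxP [Q cQ] := schmidt_sub ((col_base u)^t*).
have uE : u = S^t* *m (Q^t* *m row_base u).
  by rewrite mulmxA -adj_mul -cQ adj_adj mulmx_base.
have : row_free (Q^t* *m row_base u).
  rewrite /row_free eqn_leq rank_leq_row /=.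
  by rewrite [in leqLHS]uE mxrankM_maxr.
case/row_freeP => h' hh'.
by exists (S^t*), (Q^t* *m row_base u), h'; rewrite adj_adj.
Qed.

(** Families with equal Gram matrices differ by an isometry. The defect [w *m (1%:M - h' *m h)] has
    zero Gram matrix. *)
Lemma gram_factor l n r (h : 'M[C]_(r, n)) (h' : 'M[C]_(n, r)) (w : 'M[C]_(l, n)) :
  h *m h' = 1%:M -> w^t* *m w = h^t* *m h ->
  (w *m h')^t* *m (w *m h') = 1%:M /\ w = w *m h' *m h.
Proof.
move=> hh' ww; split.
  by rewrite adj_mul !mulmxA -(mulmxA _ _ w) ww !mulmxA -adj_mul hh' adj1 mul1mx -?mulmxA ?hh'.
apply/eqP; rewrite -subr_eq0; apply/eqP; set x := _ - _.
have -> : x = w *m (1%:M - h' *m h) by rewrite mulmxBr mulmx1 mulmxA.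
apply: n2_gram; rewrite adj_mul !mulmxA -(mulmxA _ _ w) ww -!mulmxA.
by rewrite mulmxBr mulmx1 (mulmxA h h') hh' mul1mx subrr !mulmx0.
Qed.

(** The last two conditions make the ranges of [A] and [B] reducing for all [L j], so that [L] is,
    up to isometries, the direct sum of [K] and a rest. *)
Definition summand p' p a b g (L : 'I_g -> 'M[C]_(p', p)) (K : 'I_g -> 'M[C]_(a, b))
    (A : 'M[C]_(p', a)) (B : 'M[C]_(p, b)) :=
  [/\ A^t* *m A = 1%:M, B^t* *m B = 1%:M,
      forall j, L j *m B = A *m K j &
      forall j, (L j)^t* *m A = B *m (K j)^t*].

Lemma act_mull p' p q' q g n' n (L : 'I_g -> 'M[C]_(p', p)) (L2 : 'I_g -> 'M[C]_(q', q))
    (A : 'M[C]_(p', q')) (B : 'M[C]_(p, q)) (X : 'I_g -> 'M[C]_(n', n)) u :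
  (forall j, L j *m B = A *m L2 j) -> act L X (B *m u) = A *m act L2 X u.
Proof.
move=> h; rewrite /act mulmx_sumr; apply: eq_bigr => j _.
by rewrite !mulmxA h.
Qed.

Definition matched p' p l' l g n (L : 'I_g -> 'M[C]_(p', p)) (M : 'I_g -> 'M[C]_(l', l))
    (X : 'I_g -> 'M[C]_n) k u v w w' :=
  [/\ sing L X k u v, sing M X k w w' & forall j, coef (M j) w w' = coef (L j) u v].

Lemma sing_k0 p' p g n (L : 'I_g -> 'M[C]_(p', p)) (X : 'I_g -> 'M[C]_n) k u v :
  sing L X k u v -> k != 0.
Proof.
move=> [_ hu u1]; apply/eqP => k0; move: u1; rewrite hu k0 n2Z expr0n mul0r => /esym/eqP.
by rewrite oner_eq0.
Qed.

(** * Common summands from matched singular vectors *)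

Section Matched.
Variables (p' p l' l g n : nat).
Variables (L : 'I_g -> 'M[C]_(p', p)) (M : 'I_g -> 'M[C]_(l', l)).
Variables (X : 'I_g -> 'M[C]_n) (k : R).
Variables (u : 'M[C]_(p, n)) (v : 'M[C]_(p', n)) (w : 'M[C]_(l, n)) (w' : 'M[C]_(l', n)).
Hypothesis m : matched L M X k u v w w'.

(** The singular equations recover the Gram matrices of a pair from [X], [k] and its functional;
    matched pairs therefore have equal Gram matrices. *)
Lemma coef_sum_v q' q (N : 'I_g -> 'M[C]_(q', q)) (x : 'M[C]_(q, n)) y :
  sing N X k x y -> y^t* *m y = rc k *: \sum_j coef (N j) x y *m X j.
Proof.
move=> [hy _ _]; rewrite {2}hy -scalemxAr mulmx_sumr; congr (_ *: _).
by apply: eq_bigr => j _; rewrite /coef !mulmxA.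
Qed.

Lemma coef_sum_u q' q (N : 'I_g -> 'M[C]_(q', q)) (x : 'M[C]_(q, n)) y :
  sing N X k x y -> x^t* *m x = rc k *: \sum_j X j *m coef (N j) x y.
Proof.
move=> [_ hx _]; rewrite {1}hx adjZ conj_rc -scalemxAl; congr (_ *: _).
rewrite /coact /act /adjf adj_sum mulmx_suml.
by apply: eq_bigr => j _; rewrite /coef !adj_mul !adj_adj !mulmxA.
Qed.

Lemma matched_gram_u : w^t* *m w = u^t* *m u.
Proof.
case: m => hL hM hc; rewrite (coef_sum_u hL) (coef_sum_u hM).
by congr (_ *: _); apply: eq_bigr => j _; rewrite hc.
Qed.

Lemma matched_gram_v : w'^t* *m w' = v^t* *m v.
Proof.
case: m => hL hM hc; rewrite (coef_sum_v hL) (coef_sum_v hM).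
by congr (_ *: _); apply: eq_bigr => j _; rewrite hc.
Qed.

(** The four hypotheses say that the ranges of the singular vectors are reducing. The common summand
    is the compression of either pencil to these ranges; by equality of Gram matrices the same
    coordinates [h] and [f] serve both sides. *)
Lemma matched_summand :
  (forall j, exists T, L j *m u = v *m T) -> (forall j, exists T, (L j)^t* *m v = u *m T) ->
  (forall j, exists T, M j *m w = w' *m T) -> (forall j, exists T, (M j)^t* *m w' = w *m T) ->
  exists a b K A B A2 B2, [/\ @summand p' p a b g L K A B,
    summand M K A2 B2,
    exists h h', [/\ u = B *m h, h *m h' = 1%:M & w = B2 *m h] &
    exists h h', [/\ v = A *m h, h *m h' = 1%:M & w' = A2 *m h]].
Proof.
move=> Lu Lv Mw Mw'.
have [b [B [h [h' [BB uB hh']]]]] := isom_factor u.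
have [a [A [f [f' [AA vA ff']]]]] := isom_factor v.
have gw : w^t* *m w = h^t* *m h.
  by rewrite matched_gram_u uB adj_mul !mulmxA -(mulmxA _ _ B) BB mulmx1.
have gw' : w'^t* *m w' = f^t* *m f.
  by rewrite matched_gram_v vA adj_mul !mulmxA -(mulmxA _ _ A) AA mulmx1.
have [B2B2 wB2] := gram_factor hh' gw.
have [A2A2 wA2] := gram_factor ff' gw'.
move: (w *m h') (w' *m f') B2B2 wB2 A2A2 wA2 => B2 A2 B2B2 wB2 A2A2 wA2.
(* A range inclusion becomes an intertwining relation once [x] is cancelled by its right inverse. *)
have intertwine q1 q2 r1 r2 n1 n2 (N : 'M[C]_(q1, q2)) (D : 'M[C]_(q2, r2)) (E : 'M[C]_(q1, r1))
    (x : 'M[C]_(r2, n1)) x' (y : 'M[C]_(r1, n2)) T :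
    x *m x' = 1%:M -> E^t* *m E = 1%:M ->
    N *m (D *m x) = E *m y *m T -> N *m D = E *m (E^t* *m N *m D).
  move=> xx' EE e; have NE : N *m D = E *m (y *m T *m x').
    by rewrite -[LHS]mulmx1 -xx' !mulmxA -(mulmxA N) e -!mulmxA.
  by rewrite -!mulmxA NE (mulmxA _ E) EE mul1mx.
(* The matched coefficients are the two compressions flanked by [f^t*] and [h], which are cancelled
   by one-sided inverses. *)
have coefE j : A2^t* *m M j *m B2 = A^t* *m L j *m B.
  have cancel (Z : 'M[C]_(a, b)) : f'^t* *m (f^t* *m Z *m h) *m h' = Z.
    by rewrite -!mulmxA hh' mulmx1 mulmxA -adj_mul ff' adj1 mul1mx.
  have e : f^t* *m (A2^t* *m M j *m B2) *m h = f^t* *m (A^t* *m L j *m B) *m h.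
    case: m => _ _ /(_ j); rewrite /coef {1}wB2 {1}wA2 uB vA (adj_mul A2) (adj_mul A).
    by rewrite -!mulmxA.
  exact: etrans (esym (cancel _)) (etrans (congr1 (fun z => f'^t* *m z *m h') e) (cancel _)).
exists a, b, (fun j => A^t* *m L j *m B), A, B, A2, B2; split.
- split=> // j.
    by have [T e] := Lu j; apply: (intertwine _ _ _ _ _ _ _ _ _ _ _ f T hh' AA); rewrite -uB -vA.
  have [T e] := Lv j; rewrite !adj_mul adj_adj (mulmxA (B^t*)).
  rewrite uB vA in e.
  exact: (intertwine _ _ _ _ _ _ _ _ _ _ _ h T ff' BB e).
- split=> // j.
    rewrite -coefE; have [T e] := Mw j.
    by apply: (intertwine _ _ _ _ _ _ _ _ _ _ _ f T hh' A2A2); rewrite -wB2 -wA2.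
  have [T e] := Mw' j; rewrite -coefE !adj_mul adj_adj (mulmxA (B2^t*)).
  apply: (intertwine _ _ _ _ _ _ _ _ _ _ _ h T ff' B2B2); rewrite -wA2 -wB2; exact: e.
- by exists h, h'.
- by exists f, f'.
Qed.

End Matched.
End Summand.

(** * Bordered tuples *)

Section Perturbation.
Variable R : realType.
Local Notation C := (Cplx R).

Lemma sqrD_mul (a b s : R) :
  (a + b) ^+ 2 * s = a ^+ 2 * s + 2 * (a * b * s) + b ^+ 2 * s.
Proof. by ring. Qed.

Lemma n2_triangle m n (x y : 'M[C]_(m, n)) a b s : 0 <= a -> 0 <= b -> 0 <= s ->
  n2 x <= a ^+ 2 * s -> n2 y <= b ^+ 2 * s -> n2 (x + y) <= (a + b) ^+ 2 * s.
Proof.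
move=> a0 b0 s0 hx hy.
have s2 : s = Num.sqrt s ^+ 2 by rewrite sqr_sqrtr.
have := @rdot_le _ _ _ x y (a * Num.sqrt s) (b * Num.sqrt s).
rewrite !exprMn -s2 => /(_ _ _ hx hy) h.
have {}h : rdot x y <= a * b * s.
  have -> : a * b * s = (a * Num.sqrt s) * (b * Num.sqrt s).
    by rewrite mulrACA -expr2 -s2.
  by apply: h; rewrite mulr_ge0 ?sqrtr_ge0.
rewrite n2D; move: hx hy h; move: (n2 x) (n2 y) (rdot x y) => c d e hx hy h.
have -> : (a + b) ^+ 2 * s = a ^+ 2 * s + 2 * (a * b * s) + b ^+ 2 * s.
  exact: sqrD_mul.
by apply: lerD hy; apply: lerD hx _; rewrite ler_pM2l ?ltr0n.
Qed.

Lemma nrm_shift_le p' p g n (L : 'I_g -> 'M[C]_(p', p)) (X Y : 'I_g -> 'M[C]_n) e :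
  nrm L (shift X Y e) <= nrm L X + `|e| * nrm L Y.
Proof.
have h0 : 0 <= `|e| * nrm L Y by rewrite mulr_ge0 ?nrm_ge0.
apply: nrm_le => [|u]; first by rewrite addr_ge0 ?nrm_ge0.
rewrite act_shift; apply: n2_triangle; rewrite ?nrm_ge0 ?n2_ge0 //.
  exact: nrm_ub.
rewrite n2Z exprMn real_normK ?num_real // -(mulrA (e ^+ 2)).
exact: (ler_wpM2l (sqr_ge0 _) (nrm_ub _ _ _)).
Qed.

Lemma shiftK g m n (X Y : 'I_g -> 'M[C]_(m, n)) e : shift (shift X Y e) Y (- e) = X.
Proof.
by apply: funext => j; rewrite /shift -addrA -scalerDl -rmorphD subrr rmorph0 scale0r addr0.
Qed.

Lemma nrm_shift_ge p' p g n (L : 'I_g -> 'M[C]_(p', p)) (X Y : 'I_g -> 'M[C]_n) e :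
  nrm L X - `|e| * nrm L Y <= nrm L (shift X Y e).
Proof.
by rewrite lerBlDr -[in leLHS](shiftK X Y e) -[`|e|]normrN nrm_shift_le.
Qed.

Lemma lt_shift_small (a b x y e d : R) : 0 <= x -> 0 <= y -> 0 < e ->
  d = (b - a) / (x + y + 1) -> e < d -> a + e * x < b - e * y.
Proof.
move=> x0 y0 e0 ->; have h : 0 < x + y + 1 by rewrite ltr_wpDl // addr_ge0.
by rewrite ltr_pdivlMr // => h2; lra.
Qed.

(** Norms are Lipschitz along a shift, so a strict inequality persists for small [e]. *)
Lemma nrm_lt_shift q' q p' p g n (N : 'I_g -> 'M[C]_(q', q)) (L : 'I_g -> 'M[C]_(p', p))
    (X Y : 'I_g -> 'M[C]_n) : nrm N X < nrm L X ->
  exists2 d, 0 < d & forall e, 0 < e < d -> nrm N (shift X Y e) < nrm L (shift X Y e).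
Proof.
move=> h; have x0 := nrm_ge0 N Y; have y0 := nrm_ge0 L Y.
exists ((nrm L X - nrm N X) / (nrm N Y + nrm L Y + 1)).
  by rewrite divr_gt0 ?subr_gt0 // ltr_wpDl // addr_ge0.
move=> e /andP[e0 ed].
have := lt_shift_small x0 y0 e0 erefl ed => h1.
apply: le_lt_trans (nrm_shift_le _ _ _ _) _.
apply: lt_le_trans (nrm_shift_ge _ _ _ _).
by rewrite gtr0_norm.
Qed.

(** One identity block at position [j] in a row of [g] blocks; [inc_mul] expresses orthonormality of
    these rows. *)
Definition inc g n (j : 'I_g) : 'M[C]_(n, g * n) :=
  \matrix_(i, k) (k == mxvec_index j i)%:R.

Lemma mxvec_index_inj m n (i i' : 'I_m) (j j' : 'I_n) :
  (mxvec_index i j == mxvec_index i' j') = (i == i') && (j == j').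
Proof.
apply/eqP/andP => [|[/eqP -> /eqP ->]//].
pose P : 'M[('I_m * 'I_n)%type]_(m, n) := \matrix_(a, b) (a, b).
move=> h; have := congr1 (fun k => mxvec P 0 k) h.
by rewrite !mxvecE !mxE => -[-> ->].
Qed.

Lemma inc_mul g n m i j (a : 'M[C]_(m, n)) :
  a *m inc n i *m (@inc g n j)^t* = if i == j then a else 0.
Proof.
rewrite -mulmxA; suff -> : @inc g n i *m (@inc g n j)^t* = (i == j)%:R%:M.
  by case: ifP => _; rewrite ?mulmx1 // raddf0 mulmx0.
apply/matrixP => k l; rewrite !mxE (bigD1 (mxvec_index i k)) //= !mxE eqxx mul1r.
rewrite big1 ?addr0 => [|x /negbTE h]; last by rewrite !mxE h mul0r.
rewrite mxvec_index_inj; case: eqVneq => _; case: eqVneq => _ //=;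
  by rewrite ?mulr1n ?mulr0n ?mul0rn ?conjC0 ?conjC1.
Qed.

Definition pad g n m (X : 'I_g -> 'M[C]_n) : 'I_g -> 'M[C]_(n + m) :=
  fun j => block_mx (X j) 0 0 0.

Definition off g n : 'I_g -> 'M[C]_(n + g * n) :=
  fun j => block_mx 0 (inc n j) ((inc n j)^t*) 0.

Lemma row_mx_sum m n1 n2 (I : Type) (r : seq I) (F : I -> 'M[C]_(m, n1)) (G : I -> 'M[C]_(m, n2)) :
  \sum_(i <- r) row_mx (F i) (G i) = row_mx (\sum_(i <- r) F i) (\sum_(i <- r) G i).
Proof.
by elim: r => [|i r ih]; rewrite ?big_nil ?row_mx0 // !big_cons ih add_row_mx.
Qed.

Lemma act_pad p' p g n m (L : 'I_g -> 'M[C]_(p', p)) (X : 'I_g -> 'M[C]_n) a (b : 'M[C]_(p, m)) :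
  act L (pad m X) (row_mx a b) = row_mx (act L X a) 0.
Proof.
rewrite /act (eq_bigr (fun j => row_mx (L j *m a *m X j) (0 : 'M[C]_(p', m)))).
  by rewrite row_mx_sum big1_eq.
by move=> j _; rewrite mul_mx_row mul_row_block !mulmx0 !addr0.
Qed.

Lemma act_off p' p g n (L : 'I_g -> 'M[C]_(p', p)) (a : 'M[C]_(p, n)) b :
  act L (@off g n) (row_mx a b) =
  row_mx (act L (adjf (@inc g n)) b) (act L (@inc g n) a).
Proof.
rewrite /act -row_mx_sum; apply: eq_bigr => j _.
by rewrite mul_mx_row mul_row_block !mulmx0 add0r addr0.
Qed.

Lemma adjf_pad g n m (X : 'I_g -> 'M[C]_n) : adjf (pad m X) = pad m (adjf X).
Proof. by apply: funext => j; rewrite /adjf /pad adj_block !adj0. Qed.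

Lemma adjf_off g n : adjf (@off g n) = @off g n.
Proof. by apply: funext => j; rewrite /adjf /off adj_block !adj0 adj_adj. Qed.

Lemma adjf_shift g m n (X Y : 'I_g -> 'M[C]_(m, n)) e :
  adjf (shift X Y e) = shift (adjf X) (adjf Y) e.
Proof. by apply: funext => j; rewrite /adjf /shift adjD adjZ conj_rc. Qed.

(** The border components of [act] and [coact] at this tuple list, up to the factor [e], all
    [L j *m a], respectively all [(L j)^t* *m a]. *)
Definition pert g n (X : 'I_g -> 'M[C]_n) e := shift (pad (g * n) X) (@off g n) e.

Lemma act_pert p' p g n (L : 'I_g -> 'M[C]_(p', p)) (X : 'I_g -> 'M[C]_n) e a b :
  act L (pert X e) (row_mx a b) =
  row_mx (act L X a + rc e *: act L (adjf (@inc g n)) b) (rc e *: act L (@inc g n) a).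
Proof.
by rewrite /pert act_shift act_pad act_off scale_row_mx add_row_mx add0r.
Qed.

Lemma coact_pert p' p g n (L : 'I_g -> 'M[C]_(p', p)) (X : 'I_g -> 'M[C]_n) e a b :
  coact L (pert X e) (row_mx a b) =
  row_mx (coact L X a + rc e *: act (adjf L) (adjf (@inc g n)) b)
    (rc e *: act (adjf L) (@inc g n) a).
Proof. by rewrite /coact /pert adjf_shift adjf_pad adjf_off -act_pert. Qed.

Lemma nrm_pad_le p' p g n m (L : 'I_g -> 'M[C]_(p', p)) (X : 'I_g -> 'M[C]_n) :
  nrm L (pad m X) <= nrm L X.
Proof.
apply: nrm_le (nrm_ge0 _ _) _ => u; rewrite -[u]hsubmxK act_pad !n2_row n20 addr0.
apply: le_trans (nrm_ub _ _ _) _; apply: ler_wpM2l (sqr_ge0 _) _ _ _.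
by rewrite lerDl; exact: n2_ge0.
Qed.

Lemma nrm_pert_ge p' p g n (L : 'I_g -> 'M[C]_(p', p)) (X : 'I_g -> 'M[C]_n) e :
  nrm L X <= nrm L (pert X e).
Proof.
apply: nrm_le (nrm_ge0 _ _) _ => u.
have := nrm_ub L (pert X e) (row_mx u 0); rewrite act_pert !n2_row n20 addr0.
apply: le_trans; rewrite (_ : act L _ 0 = 0) ?scaler0 ?addr0 ?lerDl ?n2_ge0 //.
by rewrite /act big1 // => j _; rewrite mulmx0 mul0mx.
Qed.

Lemma act_inc_block p' p g n (L : 'I_g -> 'M[C]_(p', p)) (a : 'M[C]_(p, n)) j :
  act L (@inc g n) a *m (inc n j)^t* = L j *m a.
Proof.
rewrite /act mulmx_suml (bigD1 j) //= inc_mul eqxx big1 ?addr0 // => i /negbTE ij.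
by rewrite inc_mul ij.
Qed.

Section Extremal.
Variables (p' p l' l q' q g : nat).
Variables (L : 'I_g -> 'M[C]_(p', p)) (M : 'I_g -> 'M[C]_(l', l)) (N : 'I_g -> 'M[C]_(q', q)).
Hypothesis LM : forall n (X : 'I_g -> 'M[C]_n), nrm N X < nrm L X -> nrm M X = nrm L X.

(** The bound [1 <= nrm L X] keeps the inverse norm [k] in the compact interval from 0 to 1, and it
    survives bordering by [nrm_pert_ge]. *)
Definition good n (X : 'I_g -> 'M[C]_n) := nrm N X < nrm L X /\ 1 <= nrm L X.

(** The strict inequality in [good] is open, so [L] and [M] have equal norms along short shifts of
    [X] and [sing_match] applies. *)
Lemma good_matched n (X : 'I_g -> 'M[C]_n) : good X ->
  exists k u v w w', [/\ 0 <= k, k <= 1 & matched L M X k u v w w'].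
Proof.
move=> [lt L1]; have pos : 0 < nrm L X := lt_le_trans ltr01 L1.
have [Y|u [v [w [w' [h1 h2 h3]]]]] := sing_match pos (LM lt).
  have [d d0 h] := nrm_lt_shift Y lt; exists d; first exact: d0.
  by move=> e /h; apply: LM.
exists (nrm L X)^-1, u, v, w, w'; split; first by rewrite invr_ge0 nrm_ge0.
  by rewrite invf_le1.
by split.
Qed.

(** The largest such [r] is the maximum, over good tuples, of the smallest rank of a matched
    quadruple with [k] between 0 and 1. *)
Definition min_rank r := exists n (X : 'I_g -> 'M[C]_n), good X /\
  forall k u v w w', 0 <= k -> k <= 1 -> matched L M X k u v w w' ->
    (r <= \rank u + \rank v)%N.

Lemma good_pert n (X : 'I_g -> 'M[C]_n) : good X ->
  exists2 d, 0 < d & forall e, 0 < e < d -> good (pert X e).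
Proof.
move=> [lt L1].
have lt' : nrm N (pad (g * n) X) < nrm L X by exact: le_lt_trans (nrm_pad_le _ _ _) lt.
pose y := nrm N (@off g n).
have y0 : 0 <= y := nrm_ge0 _ _.
exists ((nrm L X - nrm N (pad (g * n) X)) / (y + 0 + 1)).
  by rewrite divr_gt0 ?subr_gt0 // addr0 ltr_wpDl.
move=> e /andP[e0 ed]; split; last exact: le_trans L1 (nrm_pert_ge _ _ _).
have := lt_shift_small y0 (lexx 0) e0 erefl ed; rewrite mulr0 subr0 => h1.
apply: le_lt_trans (nrm_shift_le _ _ _ _) _.
apply: lt_le_trans (nrm_pert_ge _ _ _).
by rewrite gtr0_norm.
Qed.

End Extremal.
End Perturbation.

(** * Extremal rank forces reducing ranges *)

Section Reduction.
Variable R : realType.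
Local Notation C := (Cplx R).

Lemma fst_cont (T U V : topologicalType) (F : T -> (U * V)%type) :
  continuous F -> continuous (fun t => (F t).1).
Proof. by move=> cF x; apply: (@continuous_comp _ _ _ F fst); [exact: cF|exact: cvg_fst]. Qed.

Lemma snd_cont (T U V : topologicalType) (F : T -> (U * V)%type) :
  continuous F -> continuous (fun t => (F t).2).
Proof. by move=> cF x; apply: (@continuous_comp _ _ _ F snd); [exact: cF|exact: cvg_snd]. Qed.

Lemma id_cont (T : topologicalType) : continuous (fun t : T => t).
Proof. by move=> x; exact: cvg_id. Qed.

Lemma closed_sing p' p g n (L : 'I_g -> 'M[C]_(p', p)) (T : topologicalType)
    (X : T -> 'I_g -> 'M[C]_n) (k : T -> R) u v :
  (forall j, mcont (fun t => X t j)) -> continuous k -> mcont u -> mcont v ->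
  closed [set t | sing L (X t) (k t) (u t) (v t)].
Proof.
move=> cX ck cu cv.
have -> : [set t | sing L (X t) (k t) (u t) (v t)] =
    [set t | v t = rc (k t) *: act L (X t) (u t) /\
      u t = rc (k t) *: coact L (X t) (v t) /\ n2 (u t) = 1].
  by rewrite predeqE => t; split=> [[a b c]|[a [b c]]].
have ca := mcont_act (L := L) cX cu.
have cc := mcont_act (L := adjf L) (fun j => mcont_adj (cX j)) cv.
apply: closed_and; first exact: (closed_mxeq cv (mcontZ ck ca)).
apply: closed_and; first exact: (closed_mxeq cu (mcontZ ck cc)).
exact: (closed_eqr (mcont_rdot cu cu) (@cst_cont _ R 1)).
Qed.

Lemma nrm_scale_le p' p g n (L : 'I_g -> 'M[C]_(p', p)) (X : 'I_g -> 'M[C]_n) c :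
  nrm L (fun j => rc c *: X j) <= `|c| * nrm L X.
Proof.
apply: nrm_le => [|u]; first by rewrite mulr_ge0 ?nrm_ge0.
have -> : act L (fun j => rc c *: X j) u = rc c *: act L X u.
  by rewrite /act scaler_sumr; apply: eq_bigr => j _; rewrite scalemxAr.
rewrite n2Z exprMn real_normK ?num_real // -(mulrA (c ^+ 2)).
exact: (ler_wpM2l (sqr_ge0 _) (nrm_ub _ _ _)).
Qed.

Lemma nrm_scale p' p g n (L : 'I_g -> 'M[C]_(p', p)) (X : 'I_g -> 'M[C]_n) c : c != 0 ->
  nrm L (fun j => rc c *: X j) = `|c| * nrm L X.
Proof.
move=> c0; apply/eqP; rewrite eq_le nrm_scale_le /=.
rewrite -ler_pdivlMl ?normr_gt0 // -normfV.
have {1}-> : X = (fun j => rc c^-1 *: (rc c *: X j)).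
  by apply: funext => j; rewrite scalerA -rcM mulVf // scale1r.
exact: nrm_scale_le.
Qed.

(* The blocks [act _ inc _] are, up to a scalar, the components along the border
   of singular vectors at [pert X e]. *)
Definition border_mx p' p g n (L : 'I_g -> 'M[C]_(p', p)) (a : 'M[C]_(p, n))
    (c : 'M[C]_(p', n)) :=
  block_mx (row_mx a (act (adjf L) (@inc R g n) c)) 0 0 (row_mx c (act L (@inc R g n) a)).

(** By the singular equations the border components of [u] and [v] are [k * e] times the off-range
    blocks of [border_mx], and a nonzero factor does not change the rank. *)
Lemma border_rank_le p' p g n (L : 'I_g -> 'M[C]_(p', p)) (X : 'I_g -> 'M[C]_n) e k
    (u : 'M[C]_(p, n + g * n)) v : e != 0 -> sing L (pert X e) k u v ->
  (\rank (border_mx L (lsubmx u) (lsubmx v)) <= \rank u + \rank v)%N.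
Proof.
move=> e0 s; have k0 := sing_k0 s; case: s => hv hu _.
have ke0 : k * e != 0 by rewrite mulf_neq0.
have hu2 : rsubmx u = rc (k * e) *: act (adjf L) (@inc R g n) (lsubmx v).
  rewrite hu -{1}[v]hsubmxK coact_pert scale_row_mx row_mxKr scalerA -rcM.
  by [].
have hv2 : rsubmx v = rc (k * e) *: act L (@inc R g n) (lsubmx u).
  rewrite hv -{1}[u]hsubmxK act_pert scale_row_mx row_mxKr scalerA -rcM.
  by [].
rewrite /border_mx rank_diag_block_mx leq_add //.
  apply: leq_trans (rank_row_scale _ _ ke0) _; by rewrite -hu2 hsubmxK.
apply: leq_trans (rank_row_scale _ _ ke0) _; by rewrite -hv2 hsubmxK.
Qed.

(** Neither diagonal block can gain rank, so the added columns are combinations of those of [a] and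
    of [c]; [act_inc_block] then reads off each letter. *)
Lemma border_rank_reduce p' p g n (L : 'I_g -> 'M[C]_(p', p)) (a : 'M[C]_(p, n)) c :
  (\rank (border_mx L a c) <= \rank a + \rank c)%N ->
  (forall j, exists T, L j *m a = c *m T) /\ (forall j, exists T, (L j)^t* *m c = a *m T).
Proof.
rewrite /border_mx rank_diag_block_mx.
set x := act (adjf L) _ _; set y := act L _ _ => h.
have ha : (\rank a <= \rank (row_mx a x))%N.
  have {1}-> : a = row_mx a x *m col_mx 1%:M 0 by rewrite mul_row_col mulmx1 mulmx0 addr0.
  exact: mxrankM_maxl.
have hc : (\rank c <= \rank (row_mx c y))%N.
  have {1}-> : c = row_mx c y *m col_mx 1%:M 0 by rewrite mul_row_col mulmx1 mulmx0 addr0.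
  exact: mxrankM_maxl.
have /rank_row_sub [T xT] : (\rank (row_mx a x) <= \rank a)%N.
  by rewrite -(leq_add2r (\rank c)) (leq_trans _ h) // leq_add2l.
have /rank_row_sub [T' yT'] : (\rank (row_mx c y) <= \rank c)%N.
  by rewrite -(leq_add2l (\rank a)) (leq_trans _ h) // leq_add2r.
split=> j.
  by exists (T' *m (inc R n j)^t*); rewrite mulmxA -yT' act_inc_block.
by exists (T *m (inc R n j)^t*); rewrite mulmxA -xT act_inc_block.
Qed.

Lemma rc0 : rc 0 = 0 :> C. Proof. by []. Qed.

Lemma sing_pert0 p' p g n (L : 'I_g -> 'M[C]_(p', p)) (X : 'I_g -> 'M[C]_n) k
    (u : 'M[C]_(p, n + g * n)) v : sing L (pert X 0) k u v ->
  [/\ u = row_mx (lsubmx u) 0, v = row_mx (lsubmx v) 0 &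
    sing L X k (lsubmx u) (lsubmx v)].
Proof.
case=> hv hu u1; rewrite -[u in X in v = X]hsubmxK act_pert in hv.
rewrite -[v in X in u = X]hsubmxK coact_pert in hu.
rewrite rc0 !scale0r addr0 scale_row_mx scaler0 in hv.
rewrite rc0 !scale0r addr0 scale_row_mx scaler0 in hu.
have hv1 : lsubmx v = rc k *: act L X (lsubmx u) by rewrite hv row_mxKl.
have hu1 : lsubmx u = rc k *: coact L X (lsubmx v) by rewrite hu row_mxKl.
have eu : u = row_mx (lsubmx u) 0 by rewrite {1}hu hu1.
split=> //; first by rewrite {1}hv hv1.
by split=> //; rewrite eu n2_row n20 addr0 in u1.
Qed.

Section Extremal.
Variables (p' p l' l q' q g : nat).
Variables (L : 'I_g -> 'M[C]_(p', p)) (M : 'I_g -> 'M[C]_(l', l)) (N : 'I_g -> 'M[C]_(q', q)).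
Hypothesis LM : forall n (X : 'I_g -> 'M[C]_n), nrm N X < nrm L X -> nrm M X = nrm L X.

Lemma matched_rank n (X : 'I_g -> 'M[C]_n) k u v w w' : matched L M X k u v w w' ->
  \rank w = \rank u /\ \rank w' = \rank v.
Proof.
move=> m; split.
  by rewrite -(mxrank_gram w) -(mxrank_gram u) (matched_gram_u m).
by rewrite -(mxrank_gram w') -(mxrank_gram v) (matched_gram_v m).
Qed.

(** For the largest [r], each [pert X e] with small [e] has a matched quadruple of rank at most [r].
    This bounds its border matrices, the bounds pass to the limit, and the limit quadruple at [X]
    has rank at least [r]. *)
Lemma matched_reducing n0 (X0 : 'I_g -> 'M[C]_n0) : nrm N X0 < nrm L X0 ->
  exists n (X : 'I_g -> 'M[C]_n) k u v w w', [/\ matched L M X k u v w w',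
    (\rank (border_mx L u v) <= \rank u + \rank v)%N &
    (\rank (border_mx M w w') <= \rank w + \rank w')%N].
Proof.
move=> lt0.
have pos0 : 0 < nrm L X0 := le_lt_trans (nrm_ge0 _ _) lt0.
have ninv0 : (nrm L X0)^-1 != 0 by rewrite invr_eq0 gt_eqF.
have good0 : good L N (fun j => rc (nrm L X0)^-1 *: X0 j).
  rewrite /good !nrm_scale //; split.
    by rewrite ltr_pM2l // normr_gt0.
  by rewrite ger0_norm ?invr_ge0 ?nrm_ge0 // mulVf // gt_eqF.
(* Matched ranks are bounded by [p + p'], so a largest [r] exists. *)
have [r [rmin rmax]] : exists r, min_rank L M N r /\ ~ min_rank L M N r.+1.
  apply: contrapT => no.
  have all r : min_rank L M N r.
    elim: r => [|r ih]; first by exists n0, (fun j => rc (nrm L X0)^-1 *: X0 j).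
    by apply: contrapT => h; apply: no; exists r.
  have [n [X [gX h]]] := all (p + p').+1.
  have [k [u [v [w [w' [k0 k1 m]]]]]] := good_matched LM gX.
  have := h _ _ _ _ _ k0 k1 m; rewrite leqNgt ltnS.
  by rewrite leq_add // rank_leq_row.
have [n [X [gX Xmin]]] := rmin.
have [d d0 gpert] := good_pert gX.
pose n' := (n + g * n)%N.
pose T := ((R * ('M[C]_(p, n') * 'M[C]_(p', n'))) * ('M[C]_(l, n') * 'M[C]_(l', n')))%type.
pose K : set T := (`[0, 1] `*` (@mball R p n' `*` @mball R p' n')) `*`
  (@mball R l n' `*` @mball R l' n').
have cK : compact K.
  apply: compact_setX; apply: compact_setX; try exact: mball_compact.
    exact: segment_compact.
  by apply: compact_setX; exact: mball_compact.
(* The rank bounds concern [border_mx] because the border components of [u] and [v] vanish at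
   [e = 0], while its blocks carry no factor [e]. *)
pose D := [set t : R * T |
  sing L (pert X t.1) t.2.1.1 t.2.1.2.1 t.2.1.2.2 /\
  sing M (pert X t.1) t.2.1.1 t.2.2.1 t.2.2.2 /\
  (forall j, coef (M j) t.2.2.1 t.2.2.2 = coef (L j) t.2.1.2.1 t.2.1.2.2) /\
  (\rank (border_mx L (lsubmx t.2.1.2.1) (lsubmx t.2.1.2.2)) <= r)%N /\
  (\rank (border_mx M (lsubmx t.2.2.1) (lsubmx t.2.2.2)) <= r)%N].
have idc := @id_cont (R * T)%type.
have c2 := snd_cont idc.
have c21 := fst_cont c2.
have c22 := snd_cont c2.
have ce : continuous (fun t : R * T => t.1) := fst_cont idc.
have ck : continuous (fun t : R * T => t.2.1.1) := fst_cont c21.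
have c212 := snd_cont c21.
have cu := mcont_proj (fst_cont c212).
have cv := mcont_proj (snd_cont c212).
have cw := mcont_proj (fst_cont c22).
have cw' := mcont_proj (snd_cont c22).
have cX j : mcont (fun t : R * T => pert X t.1 j).
  by apply: mcontD; [exact: mcont_cst|apply: mcontZ ce _; exact: mcont_cst].
have ccoef s' s (A : 'M[C]_(s', s)) (x : R * T -> 'M[C]_(s, n')) y :
    mcont x -> mcont y -> mcont (fun t => coef A (x t) (y t)).
  move=> cx cy; apply: mcontM cx; apply: mcontM; [exact: mcont_adj|exact: mcont_cst].
have cbord s' s (A : 'I_g -> 'M[C]_(s', s)) (x : R * T -> 'M[C]_(s, n')) y :
    mcont x -> mcont y -> mcont (fun t => border_mx A (lsubmx (x t)) (lsubmx (y t))).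
  move=> cx cy; apply: mcont_block; [|exact: mcont_cst|exact: mcont_cst|].
    apply: mcont_row (mcont_lsub cx) _.
    exact: (mcont_act (L := adjf A) (fun j => @mcont_cst R _ _ _ (inc R n j)) (mcont_lsub cy)).
  apply: mcont_row (mcont_lsub cy) _.
  exact: (mcont_act (L := A) (fun j => @mcont_cst R _ _ _ (inc R n j)) (mcont_lsub cx)).
have cD : closed D.
  apply: closed_and; first exact: (closed_sing (L := L) cX ck cu cv).
  apply: closed_and; first exact: (closed_sing (L := M) cX ck cw cw').
  apply: closed_and.
    by apply: closed_all => j; apply: closed_mxeq (ccoef _ _ _ _ _ cw cw') (ccoef _ _ _ _ _ cu cv).
  by apply: closed_and; apply: closed_rank; apply: cbord.
have [e e0d|[[k [u v]] [w w']] [[/= k01 _] _]] := compact_param_limit cK cD d0.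
  have ge := gpert e e0d; have [e0 _] := andP e0d.
  have en0 : e != 0 by rewrite gt_eqF.
  have [k [u [v [w [w' [k0 k1 m rk]]]]]] : exists k u v w w',
      [/\ 0 <= k, k <= 1, matched L M (pert X e) k u v w w' & (\rank u + \rank v <= r)%N].
    apply: contrapT => no; apply: rmax; exists n', (pert X e); split=> //.
    move=> k u v w w' k0 k1 m; rewrite ltnNge; apply/negP => rk.
    by apply: no; exists k, u, v, w, w'.
  have [rw rw'] := matched_rank m.
  case: m => sL sM hc.
  have v1 := sing_n2 sL; have w'1 := sing_n2 sM.
  have u1 : n2 u = 1 by case: sL.
  have w1 : n2 w = 1 by case: sM.
  exists ((k, (u, v)), (w, w')).
    split; split; try (by apply: n2_mball; rewrite /= ?u1 ?v1 ?w1 ?w'1).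
      by rewrite /= in_itv /= k0 k1.
    by split; apply: n2_mball; rewrite /= ?u1 ?v1.
  split=> //; split=> //; split=> //; split.
    exact: leq_trans (border_rank_le en0 sL) rk.
  by apply: leq_trans (border_rank_le en0 sM) _; rewrite rw rw'.
have [k0 k1] : 0 <= k /\ k <= 1 by apply/andP; rewrite in_itv in k01.
case=> /= /sing_pert0 [eu ev sL] [/sing_pert0 [ew ew' sM]] [hc [bL bM]].
have m : matched L M X k (lsubmx u) (lsubmx v) (lsubmx w) (lsubmx w').
  split=> // j; have := hc j; rewrite /coef {1}eu {1}ev {1}ew {1}ew' !adj_row !adj0.
  by rewrite -!mulmxA !mul_mx_row !mulmx0 !mul_col_mx !mul0mx => /eq_row_mx [/eq_col_mx []].
have rk := Xmin _ _ _ _ _ k0 k1 m.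
have [rw rw'] := matched_rank m.
exists n, X, k, (lsubmx u), (lsubmx v), (lsubmx w), (lsubmx w'); split=> //.
  exact: leq_trans bL rk.
by rewrite rw rw'; exact: leq_trans bM rk.
Qed.

End Extremal.
End Reduction.

(** * Minimal pencils are direct summands *)

Section MinimalSummand.
Variable R : realType.
Local Notation C := (Cplx R).

Lemma isom_zero m n k (B : 'M[C]_(m, n)) (h : 'M[C]_(n, k)) : n = 0%N -> B *m h = 0.
Proof. by move=> n0; case: _ / (esym n0) B h => B h; rewrite thinmx0 mul0mx. Qed.

Lemma isom_dim m n (A : 'M[C]_(m, n)) : A^t* *m A = 1%:M -> (n <= m)%N.
Proof.
move=> AA; have := mxrankM_maxr (A^t*) A; rewrite AA mxrank1 => h.
exact: leq_trans h (rank_leq_row _).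
Qed.

(** The two last clauses hold because singular vectors are values of [coact] and [act], hence are
    killed by whatever annihilates all [(L j)^t*], respectively all [L j]. They place the new
    summand orthogonal to one already split off. *)
Lemma new_summand p' p l' l q' q g (L : 'I_g -> 'M[C]_(p', p)) (M : 'I_g -> 'M[C]_(l', l))
    (N : 'I_g -> 'M[C]_(q', q)) n0 (X0 : 'I_g -> 'M[C]_n0) :
  (forall n (X : 'I_g -> 'M[C]_n), nrm N X < nrm L X -> nrm M X = nrm L X) ->
  nrm N X0 < nrm L X0 ->
  exists a b (K : 'I_g -> 'M[C]_(a, b)) A B A2 B2,
    [/\ (0 < b)%N, summand L K A B, summand M K A2 B2,
      forall s (P : 'M[C]_(s, p)) (Q : 'M[C]_(s, p')),
        (forall j, P *m (L j)^t* = 0) -> (forall j, Q *m L j = 0) ->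
        P *m B = 0 /\ Q *m A = 0 &
      forall s (P : 'M[C]_(s, l)) (Q : 'M[C]_(s, l')),
        (forall j, P *m (M j)^t* = 0) -> (forall j, Q *m M j = 0) ->
        P *m B2 = 0 /\ Q *m A2 = 0].
Proof.
move=> LM lt0.
have [n [X [k [u [v [w [w' [m rL rM]]]]]]]] := matched_reducing LM lt0.
have [Lu Lv] := border_rank_reduce rL; have [Mw Mw'] := border_rank_reduce rM.
have [a [b [K [A [B [A2 [B2 [sL sM [h [h' [uB hh' wB2]]] [f [f' [vA ff' wA2]]]]]]]]]]] :=
  matched_summand m Lu Lv Mw Mw'.
have kill s' s (S : 'I_g -> 'M[C]_(s', s)) x y t (P : 'M[C]_(t, s)) (Q : 'M[C]_(t, s')) :
    sing S X k x y -> (forall j, P *m (S j)^t* = 0) -> (forall j, Q *m S j = 0) ->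
    P *m x = 0 /\ Q *m y = 0.
  move=> [hy hx _] hP hQ; split.
    rewrite hx -scalemxAr mulmx_sumr big1 ?scaler0 // => j _.
    by rewrite !mulmxA hP !mul0mx.
  rewrite hy -scalemxAr mulmx_sumr big1 ?scaler0 // => j _.
  by rewrite !mulmxA hQ !mul0mx.
have cancel r s t (P : 'M[C]_(s, t)) (D : 'M[C]_(t, r)) (x : 'M[C]_(r, n)) x' :
    x *m x' = 1%:M -> P *m (D *m x) = 0 -> P *m D = 0.
  by move=> xx' e; rewrite -[LHS]mulmx1 -xx' mulmxA -(mulmxA P) e mul0mx.
case: m => hL hM _.
exists a, b, K, A, B, A2, B2; split=> //.
- rewrite lt0n; apply/eqP => b0; case: hL => _ _; rewrite uB (isom_zero _ _ b0) n20.
  by move/esym/eqP; rewrite oner_eq0.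
- move=> s P Q hP hQ; have [e1 e2] := kill _ _ _ _ _ _ _ _ hL hP hQ.
  rewrite uB in e1; rewrite vA in e2.
  by split; [apply: cancel hh' e1|apply: cancel ff' e2].
- move=> s P Q hP hQ; have [e1 e2] := kill _ _ _ _ _ _ _ _ hM hP hQ.
  rewrite wB2 in e1; rewrite wA2 in e2.
  by split; [apply: cancel hh' e1|apply: cancel ff' e2].
Qed.

(** * Splitting off a summand *)

Section Complement.
Variables (p' p a b g : nat) (L : 'I_g -> 'M[C]_(p', p)) (K : 'I_g -> 'M[C]_(a, b)).
Variables (A : 'M[C]_(p', a)) (B : 'M[C]_(p, b)).
Hypothesis s : summand L K A B.

(* The compression of [L] to the orthogonal complements, extended by zero. *)
Definition compl j := L j - A *m K j *m B^t*.

Lemma compl_ann j :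
  [/\ compl j *m B = 0, (compl j)^t* *m A = 0, B^t* *m (compl j)^t* = 0 & A^t* *m compl j = 0].
Proof.
case: s => AA BB LB LA.
have e1 : compl j *m B = 0 by rewrite mulmxBl LB -!mulmxA BB mulmx1 subrr.
have e2 : (compl j)^t* *m A = 0.
  by rewrite adjB !adj_mul adj_adj mulmxBl LA -!mulmxA AA mulmx1 subrr.
split=> //; first by rewrite -adj_mul e1 adj0.
by rewrite -[LHS]adj_adj adj_mul adj_adj e2 adj0.
Qed.

Lemma act_compl n (X : 'I_g -> 'M[C]_n) u :
  act L X u = A *m act K X (B^t* *m u) + act compl X u.
Proof.
rewrite /act mulmx_sumr -big_split; apply: eq_bigr => j _.
by rewrite /compl !mulmxBl !mulmxA [RHS]addrC subrK.
Qed.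

Lemma n2_act_compl n (X : 'I_g -> 'M[C]_n) u :
  n2 (act L X u) = n2 (act K X (B^t* *m u)) + n2 (act compl X u).
Proof.
case: s => AA _ _ _; rewrite act_compl n2D (n2_isoml _ AA) rdot_mull.
rewrite (_ : A^t* *m act compl X u = 0) ?rdot0r ?mulr0 ?addr0 //.
rewrite /act mulmx_sumr big1 // => j _; rewrite !mulmxA.
by case: (compl_ann j) => _ _ _ ->; rewrite !mul0mx.
Qed.

Lemma nrm_summand n (X : 'I_g -> 'M[C]_n) : nrm K X <= nrm L X.
Proof.
case: s => AA BB LB _; apply: nrm_le (nrm_ge0 _ _) _ => u.
have := nrm_ub L X (B *m u); rewrite (n2_isoml _ BB).
by rewrite (act_mull X u LB) (n2_isoml _ AA).
Qed.

Lemma nrm_compl n (X : 'I_g -> 'M[C]_n) : nrm compl X <= nrm L X.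
Proof.
apply: nrm_le (nrm_ge0 _ _) _ => u; apply: le_trans (nrm_ub L X u).
by rewrite n2_act_compl lerDr n2_ge0.
Qed.

(** The splitting is orthogonal in source and target, so the norm of [L] is the larger of the norms
    of the two parts. *)
Lemma nrm_le_compl n (X : 'I_g -> 'M[C]_n) m :
  nrm K X <= m -> nrm compl X <= m -> nrm L X <= m.
Proof.
move=> Km cm; have m0 := le_trans (nrm_ge0 K X) Km.
apply: nrm_le m0 _ => u; case: (s) => _ BB _ _.
have -> : n2 (act L X u) = n2 (act K X (B^t* *m u)) + n2 (act compl X (u - B *m (B^t* *m u))).
  rewrite n2_act_compl; congr (_ + n2 _); rewrite /act; apply: eq_bigr => j _; congr (_ *m _).
  by rewrite mulmxBr (mulmxA (compl j)); case: (compl_ann j) => -> _ _ _; rewrite mul0mx subr0.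
rewrite (n2_proj u BB) mulrDr; apply: lerD.
  apply: le_trans (nrm_ub _ _ _) _; apply: ler_wpM2r; first exact: n2_ge0.
  by rewrite ler_pXn2r ?nnegrE ?nrm_ge0 // (le_trans (nrm_ge0 K X)).
apply: le_trans (nrm_ub _ _ _) _; apply: ler_wpM2r; first exact: n2_ge0.
by rewrite ler_pXn2r ?nnegrE ?nrm_ge0 // (le_trans (nrm_ge0 K X)).
Qed.

Lemma summand_add a' b' (K' : 'I_g -> 'M[C]_(a', b')) A' B' :
  summand compl K' A' B' -> B^t* *m B' = 0 -> A^t* *m A' = 0 ->
  summand L (fun j => block_mx (K j) 0 0 (K' j)) (row_mx A A') (row_mx B B').
Proof.
move=> [AA' BB' LB' LA'] oB oA; case: s => AA BB LB LA.
have isom k k1 k2 (D : 'M[C]_(k, k1)) (E : 'M[C]_(k, k2)) : D^t* *m D = 1%:M ->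
    E^t* *m E = 1%:M -> D^t* *m E = 0 -> (row_mx D E)^t* *m row_mx D E = 1%:M.
  move=> DD EE DE; have ED : E^t* *m D = 0 by rewrite -[LHS]adj_adj adj_mul adj_adj DE adj0.
  by rewrite adj_row mul_col_row DD EE DE ED -scalar_mx_block.
split; [exact: isom|exact: isom|move=> j|move=> j].
  rewrite mul_mx_row mul_row_block !mulmx0 addr0 add0r LB; congr row_mx.
  by rewrite -LB' /compl mulmxBl -!mulmxA oB !mulmx0 subr0.
rewrite adj_block !adj0 mul_mx_row mul_row_block !mulmx0 addr0 add0r LA; congr row_mx.
by rewrite -LA' /compl adjB !adj_mul adj_adj mulmxBl -!mulmxA oA !mulmx0 subr0.
Qed.

End Complement.

Lemma minimal_summand p' p l' l g (L : 'I_g -> 'M[C]_(p', p)) (M : 'I_g -> 'M[C]_(l', l)) :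
  (0 < p')%N -> (0 < p)%N ->
  (forall a b (K : 'I_g -> 'M[C]_(a, b)),
    (forall n (X : 'I_g -> 'M[C]_n), nrm K X = nrm L X) -> (p' * p <= a * b)%N) ->
  (forall n (X : 'I_g -> 'M[C]_n), nrm M X = nrm L X) ->
  exists A B, summand M L A B.
Proof.
move=> p'0 p0 min ML.
(* The search for a common summand of largest size [a + b] starts at the empty one and is bounded by
   [isom_dim]. *)
pose common r := exists a b (K : 'I_g -> 'M[C]_(a, b)) A B A2 B2,
  [/\ (r <= a + b)%N, summand L K A B & summand M K A2 B2].
have common0 : common 0%N.
  exists 0%N, 0%N, (fun=> 0), 0, 0, 0, 0; split=> //; split=> [||j|j];
    by rewrite ?adj0 ?mulmx0 ?mul0mx //; apply/matrixP => -[].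
have [r [[a [b [K [A [B [A2 [B2 [rab sL sM]]]]]]]] rmax]] : exists r, common r /\ ~ common r.+1.
  apply: contrapT => no.
  have all r : common r.
    by elim: r => [//|r ih]; apply: contrapT => h; apply: no; exists r.
  have [a [b [K [A [B [A2 [B2 [rab sL sM]]]]]]]] := all (p' + p).+1.
  case: sL => /isom_dim ha /isom_dim hb _ _.
  by move: rab; rewrite leqNgt ltnS leq_add.
(* Where [K] falls short of the norm of [L], the complements carry the norm on both sides, and
   [new_summand] with [K] as threshold enlarges [K]. *)
have KL n (X : 'I_g -> 'M[C]_n) : nrm K X = nrm L X.
  apply/eqP; rewrite eq_le (nrm_summand sL) /=; rewrite leNgt; apply/negP => lt.
  pose L' := compl L K A B; pose M' := compl M K A2 B2.
  have eqL n' (Y : 'I_g -> 'M[C]_n') : nrm K Y < nrm L' Y -> nrm L Y = nrm L' Y.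
    move=> h; apply/eqP; rewrite eq_le (nrm_compl sL) andbT.
    by apply: (nrm_le_compl sL); [exact: ltW|exact: lexx].
  have eqM n' (Y : 'I_g -> 'M[C]_n') : nrm K Y < nrm M Y -> nrm M' Y = nrm M Y.
    move=> h; apply/eqP; rewrite eq_le (nrm_compl sM) /= leNgt; apply/negP => h2.
    have : nrm M Y <= Order.max (nrm K Y) (nrm M' Y).
      by apply: (nrm_le_compl sM); rewrite le_max lexx ?orbT.
    by rewrite leNgt gt_max h h2.
  have LM' n' (Y : 'I_g -> 'M[C]_n') : nrm K Y < nrm L' Y -> nrm M' Y = nrm L' Y.
    move=> h; rewrite eqM ML; first exact: eqL.
    by rewrite (eqL _ _ h).
  have lt' : nrm K X < nrm L' X.
    rewrite ltNge; apply/negP => h; move: lt; rewrite ltNge => /negP; apply.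
    by apply: (nrm_le_compl sL); [exact: lexx|].
  have [a' [b' [K' [A' [B' [A2' [B2' [b'0 sL' sM' oL oM]]]]]]]] := new_summand LM' lt'.
  apply: rmax; exists (a + a')%N, (b + b')%N, (fun j => block_mx (K j) 0 0 (K' j)),
    (row_mx A A'), (row_mx B B'), (row_mx A2 A2'), (row_mx B2 B2'); split.
  - by move: rab b'0; lia.
  - have oB : B^t* *m B' = 0.
      by have [] := oL _ (B^t*) 0; [move=> j; case: (compl_ann sL j)|move=> j; exact: mul0mx|].
    have oA : A^t* *m A' = 0.
      by have [] := oL _ 0 (A^t*); [move=> j; exact: mul0mx|move=> j; case: (compl_ann sL j)|].
    exact: summand_add.
  - have oB : B2^t* *m B2' = 0.
      by have [] := oM _ (B2^t*) 0; [move=> j; case: (compl_ann sM j)|move=> j; exact: mul0mx|].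
    have oA : A2^t* *m A2' = 0.
      by have [] := oM _ 0 (A2^t*); [move=> j; exact: mul0mx|move=> j; case: (compl_ann sM j)|].
    exact: summand_add.
have := min _ _ K KL; case: sL sM => AA BB LB LA [AA2 BB2 MB MA] hab.
have ha := isom_dim AA; have hb := isom_dim BB.
(* Minimality against [a <= p'] and [b <= p] makes the isometries [A] and [B] square, hence
   unitary. *)
have [ea eb] : a = p' /\ b = p.
  by move: ha hb hab p'0 p0; clear; nia.
subst a b.
have AAt := mulmx1C AA; have BBt := mulmx1C BB.
exists (A2 *m A^t*), (B2 *m B^t*); split.
- by rewrite adj_mul adj_adj mulmxA -(mulmxA A) AA2 mulmx1.
- by rewrite adj_mul adj_adj mulmxA -(mulmxA B) BB2 mulmx1.
- move=> j; rewrite mulmxA MB -!mulmxA; congr (_ *m _).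
  have -> : K j = A^t* *m (L j *m B) by rewrite LB mulmxA AA mul1mx.
  by rewrite -!mulmxA BBt mulmx1.
move=> j; rewrite mulmxA MA -!mulmxA; congr (_ *m _).
have -> : (K j)^t* = B^t* *m ((L j)^t* *m A) by rewrite LA mulmxA BB mul1mx.
by rewrite -!mulmxA AAt mulmx1.
Qed.

End MinimalSummand.

(** * Power series at nilpotent block bidiagonal tuples *)

Section Chain.
Variable R : realType.
Local Notation C := (Cplx R).
Local Notation "A *t B" := (mxtens.tensmx A B) (at level 40, left associativity).

Lemma inc_tr g n (j : 'I_g) : (inc R n j)^T = (inc R n j)^t*.
Proof.
by apply/matrixP => a b; rewrite !mxE; case: (_ == _); rewrite ?conjC0 ?conjC1.
Qed.

Lemma inc_resolution g n : \sum_(i < g) (inc R n i)^T *m inc R n i = 1%:M.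
Proof.
apply/matrixP => a b; rewrite summxE.
case/mxvec_indexP: a => i k; case/mxvec_indexP: b => i' k'.
rewrite !mxE (bigD1 i) //= big1 ?addr0 => [|j ji]; last first.
  rewrite !mxE big1 // => l _; rewrite !mxE mxvec_index_inj.
  by rewrite eq_sym (negbTE ji) mul0r.
rewrite mxE (bigD1 k) //= big1 ?addr0 => [|l lk]; last first.
  by rewrite !mxE mxvec_index_inj eqxx /= eq_sym (negbTE lk) mul0r.
by rewrite !mxE eqxx mul1r eq_sym.
Qed.

Lemma n2_resolution g n m (u : 'M[C]_(m, g * n)) :
  n2 u = \sum_(i < g) n2 (u *m (inc R n i)^T).
Proof.
rewrite {1}/n2 -[in X in rdot _ X](mulmx1 u) -inc_resolution mulmx_sumr rdot_sumr.
apply: eq_bigr => i _; rewrite /n2 [in RHS]inc_tr rdot_mulr adj_adj -inc_tr.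
by rewrite mulmxA.
Qed.

Definition hom l' l g n (f : fps R l' l g) (X : mxtuple R g n) k (u : 'M[C]_(l, n)) :=
  \sum_(w : k.-tuple 'I_g) f w *m u *m (word_eval X w)^T.

Lemma homE l' l g n (f : fps R l' l g) (X : mxtuple R g n) k (u : 'M[C]_(l, n)) :
  fps_homog_eval f X k *m cv u = cv (hom f X k u).
Proof.
rewrite /fps_homog_eval mulmx_suml /hom cv_sum.
by apply: eq_bigr => w _; rewrite tens_cv.
Qed.

Lemma homD l' l g n (f : fps R l' l g) (X : mxtuple R g n) k (u v : 'M[C]_(l, n)) :
  hom f X k (u + v) = hom f X k u + hom f X k v.
Proof.
by rewrite /hom -big_split; apply: eq_bigr => w _; rewrite mulmxDr mulmxDl.
Qed.

Section Fixed.
Variables (g n k : nat) (Y : nat -> 'I_g -> 'M[C]_n).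

(** Indexing by [nat] avoids casts; [inord] gives the intended block for [i <= k]. *)
Definition slot (i : nat) : 'M[C]_(n, k.+1 * n) := inc R n (inord i : 'I_k.+1).

(** Block upper bidiagonal with [Y i] in position [(i, i.+1)], hence nilpotent: words longer than
    [k] vanish on it. *)
Definition chain : mxtuple R g (k.+1 * n) :=
  [ffun j => \sum_(i < k) (slot i)^T *m Y i j *m slot i.+1].

Lemma slot_mul i j : (i <= k)%N -> (j <= k)%N ->
  slot i *m (slot j)^T = if i == j then 1%:M else 0.
Proof.
move=> ik jk; rewrite /slot inc_tr -[inc R n (inord i)]mul1mx inc_mul.
by rewrite -val_eqE /= !inordK.
Qed.

Lemma slot_chain i j : (i <= k)%N ->
  slot i *m chain j = if (i < k)%N then Y i j *m slot i.+1 else 0.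
Proof.
move=> ik; rewrite ffunE mulmx_sumr.
have slotE b : (b < k)%N -> slot i *m ((slot b)^T *m Y b j *m slot b.+1) =
    if i == b then Y b j *m slot b.+1 else 0.
  move=> bk; rewrite !mulmxA slot_mul //; last exact: ltnW.
  by case: eqP => _; rewrite ?mul1mx // !mul0mx.
case: ltnP => [ilt|kle].
  have e0 := slotE i ilt; rewrite eqxx in e0.
  rewrite (bigD1 (Ordinal ilt)) // big1 => [|a /negbTE ai]; first exact: etrans (addr0 _) e0.
  by rewrite (slotE a (ltn_ord a)) ifF // eq_sym.
rewrite big1 // => a _; rewrite (slotE a (ltn_ord a)); case: eqP => // e.
by have := ltn_ord a; rewrite -e ltnNge kle.
Qed.

Fixpoint yprod (i : nat) (w : seq 'I_g) : 'M[C]_n :=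
  if w is j :: w' then Y i j *m yprod i.+1 w' else 1%:M.

Lemma slot_word i w : (i <= k)%N ->
  slot i *m word_eval chain w =
  if (i + size w <= k)%N then yprod i w *m slot (i + size w) else 0.
Proof.
elim: w i => [|j w ih] i ik.
  by rewrite /word_eval big_nil mulmx1 /= addn0 ik mul1mx.
have -> : word_eval chain (j :: w) = chain j *m word_eval chain w.
  by rewrite /word_eval big_cons.
rewrite mulmxA slot_chain // /= addnS -addSn.
case: ltnP => [ilt|kle]; last first.
  by rewrite mul0mx ifF //; apply/negbTE; rewrite -ltnNge addSn ltnS (leq_trans kle) ?leq_addr.
by rewrite -mulmxA ih //; case: ifP => _; rewrite ?mulmx0 // mulmxA.
Qed.

Lemma word_chain0 w : (k < size w)%N -> word_eval chain w = 0.
Proof.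
move=> kw; rewrite -[LHS]mul1mx -inc_resolution mulmx_suml big1 // => i _.
have := @slot_word i w; rewrite /slot inord_val -mulmxA => ->; last by rewrite -ltnS ltn_ord.
by rewrite ifF ?mulmx0 //; apply/negbTE; rewrite -ltnNge ltn_addl.
Qed.

Definition ymul l' l (f : fps R l' l g) m a (x : 'M[C]_(l, n)) : 'M[C]_(l', n) :=
  \sum_(w : m.-tuple 'I_g) f w *m x *m (yprod a w)^T.

(** Each letter shifts by one block, so the part of degree [m] sends block [b] to block [b - m]. *)
Lemma hom_slot l' l (f : fps R l' l g) m a b (x : 'M[C]_(l, n)) :
  (a <= k)%N -> (b <= k)%N ->
  hom f chain m (x *m slot b) *m (slot a)^T = if (a + m == b)%N then ymul f m a x else 0.
Proof.
move=> ak bk; rewrite /hom mulmx_suml.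
rewrite (eq_bigr (fun w : m.-tuple 'I_g =>
    if (a + m == b)%N then f w *m x *m (yprod a w)^T else 0)); last first.
  move=> w _; rewrite mulmxA -!mulmxA -trmx_mul slot_word // size_tuple.
  case: (leqP (a + m) k) => [amk|kam]; last first.
    by rewrite trmx0 !mulmx0 ifF //; apply/negbTE/eqP => e; move: kam; rewrite e ltnNge bk.
  rewrite trmx_mul (mulmxA (slot b)) slot_mul // eq_sym.
  by case: ifP => _; [rewrite mul1mx mulmxA|rewrite mul0mx !mulmx0].
by case: ifP => // _; rewrite big1.
Qed.

Lemma act_chain p' p (L : 'I_g -> 'M[C]_(p', p)) u a : (a <= k)%N ->
  act L (fun j => (chain j)^T) u *m (slot a)^T =
  if (a < k)%N then act L (fun j => (Y a j)^T) (u *m (slot a.+1)^T) else 0.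
Proof.
move=> ak; rewrite /act mulmx_suml.
case: ltnP => [alt|kle]; last first.
  rewrite big1 // => j _; rewrite -mulmxA -trmx_mul slot_chain // ltnNge kle /=.
  by rewrite trmx0 mulmx0.
apply: eq_bigr => j _.
by rewrite -mulmxA -trmx_mul slot_chain // alt trmx_mul !mulmxA.
Qed.

(** Distinct blocks go to distinct blocks, so the action is an orthogonal sum of the actions of the
    [Y i]. *)
Lemma nrm_chain_le p' p (L : 'I_g -> 'M[C]_(p', p)) c : 0 <= c ->
  (forall i, (i < k)%N -> nrm L (fun j => (Y i j)^T) <= c) ->
  nrm L (fun j => (chain j)^T) <= c.
Proof.
move=> c0 hc; apply: nrm_le (c0) _ => u.
rewrite (n2_resolution (act _ _ _)) (n2_resolution u).
have e (v : 'M[C]_(p', k.+1 * n)) (i : 'I_k.+1) : v *m (inc R n i)^T = v *m (slot i)^T.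
  by rewrite /slot inord_val.
have e' (v : 'M[C]_(p, k.+1 * n)) (i : 'I_k.+1) : v *m (inc R n i)^T = v *m (slot i)^T.
  by rewrite /slot inord_val.
rewrite big_ord_recr /= e act_chain // ltnn n20 addr0 mulr_sumr.
rewrite [leRHS]big_ord_recl /= ler_wpDl ?mulr_ge0 ?sqr_ge0 ?n2_ge0 //.
apply: ler_sum => i _; rewrite e act_chain /=; last exact: ltnW.
rewrite ltn_ord (e' u (lift ord0 i)) lift0.
apply: le_trans (nrm_ub _ _ _) _; apply: ler_wpM2r; first exact: n2_ge0.
by rewrite ler_pXn2r ?nnegrE ?nrm_ge0 ?hc.
Qed.

Lemma nrm_chain_ge p' p (L : 'I_g -> 'M[C]_(p', p)) i : (i < k)%N ->
  nrm L (fun j => (Y i j)^T) <= nrm L (fun j => (chain j)^T).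
Proof.
move=> ik; apply: nrm_le (nrm_ge0 _ _) _ => x.
have := nrm_ub L (fun j => (chain j)^T) (x *m slot i.+1).
have iso (m : nat) (y : 'M[C]_(m, n)) b : (b <= k)%N -> n2 (y *m slot b) = n2 y.
  move=> bk; rewrite /n2 rdot_mulr /slot -inc_tr -mulmxA -/(slot b) slot_mul //.
  by rewrite eqxx mulmx1.
rewrite iso //; apply: le_trans.
rewrite (n2_resolution (act _ _ (x *m _))) (bigD1 (inord i)) //=.
rewrite -/(slot i) act_chain; last exact: ltnW.
rewrite ik -mulmxA slot_mul // eqxx mulmx1 lerDl; apply: sumr_ge0 => a _; exact: n2_ge0.
Qed.

(** By nilpotency the partial sums are eventually constant, so [limn] is a true limit here. *)
Lemma fps_eval_chain l' l (f : fps R l' l g) :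
  series (fps_homog_eval f chain) @ \oo --> \sum_(m < k.+1) fps_homog_eval f chain m /\
  fps_eval f chain = \sum_(m < k.+1) fps_homog_eval f chain m.
Proof.
have h : \forall N \near \oo, series (fps_homog_eval f chain) N =
    \sum_(m < k.+1) fps_homog_eval f chain m.
  exists k.+1 => // N /= kN.
  rewrite /series /= (big_cat_nat (leq0n k.+1) kN) //= [X in _ + X]big_nat_cond [X in _ + X]big1 ?addr0.
    by rewrite big_mkord.
  move=> m /andP[/andP[km _] _]; rewrite /fps_homog_eval big1 // => w _.
  by rewrite word_chain0 ?size_tuple // mxtens.tensmx0.
split; first exact: cvg_near_cst.
by apply: lim_near_cst h; exact: norm_hausdorff.
Qed.

Lemma fps_eval_chain_cv l' l (f : fps R l' l g) u :
  fps_eval f chain *m cv u = cv (\sum_(m < k.+1) hom f chain m u).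
Proof.
case: (fps_eval_chain f) => _ ->; rewrite mulmx_suml cv_sum.
by apply: eq_bigr => m _; exact: homE.
Qed.

Lemma sum_hom_slot l' l (f : fps R l' l g) a b (x : 'M[C]_(l, n)) :
  (a <= b)%N -> (b <= k)%N ->
  (\sum_(m < k.+1) hom f chain m (x *m slot b)) *m (slot a)^T = ymul f (b - a) a x.
Proof.
move=> ab bk; rewrite mulmx_suml.
have bak : (b - a < k.+1)%N by rewrite ltnS (leq_trans (leq_subr _ _)).
rewrite (bigD1 (Ordinal bak)) //= big1 ?addr0 => [|m].
  by rewrite hom_slot ?(leq_trans ab) // subnKC // eqxx.
rewrite -val_eqE /= => h; rewrite hom_slot ?(leq_trans ab) // ifF //.
by apply/negbTE; apply: contra h => /eqP <-; rewrite addKn.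
Qed.

End Fixed.

Lemma ymulS g n (Y : nat -> 'I_g -> 'M[C]_n) l' l (f : fps R l' l g) m a x :
  ymul Y f m.+1 a x = \sum_j ymul Y (fun w => f (j :: w)) m a.+1 x *m (Y a j)^T.
Proof.
rewrite [RHS](eq_bigr (fun j => \sum_(w : m.-tuple 'I_g)
    f (j :: w) *m x *m (yprod Y a.+1 w)^T *m (Y a j)^T)); last first.
  by move=> j _; rewrite mulmx_suml.
rewrite /ymul.
rewrite pair_bigA /= (reindex (fun jw : 'I_g * m.-tuple 'I_g => [tuple of jw.1 :: jw.2])) /=.
  by apply: eq_bigr => -[j w] _ /=; rewrite trmx_mul !mulmxA.
exists (fun w : m.+1.-tuple 'I_g => (thead w, [tuple of behead w])) => [[j w] _|w _] /=.
  by congr (_, _); apply: val_inj.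
by rewrite [RHS]tuple_eta.
Qed.

Lemma ymul0 g n (Y : nat -> 'I_g -> 'M[C]_n) l' l (f : fps R l' l g) a x :
  ymul Y f 0 a x = f [::] *m x.
Proof.
rewrite /ymul (bigD1 [tuple]) //= big1 ?addr0 ?trmx1 ?mulmx1 // => w.
by move/eqP; rewrite (tuple0 w).
Qed.

Lemma ymul1 g n (Y : nat -> 'I_g -> 'M[C]_n) l' l (f : fps R l' l g) a x :
  ymul Y f 1 a x = act (fun j => f [:: j]) (fun j => (Y a j)^T) x.
Proof. by rewrite ymulS; apply: eq_bigr => j _; rewrite ymul0. Qed.

(** Scalar blocks that vanish except at the letter prescribed by [s] single out the words with
    prefix [s]. *)
Lemma ymul_scalar g n (Y : nat -> 'I_g -> 'M[C]_n) l' l (f : fps R l' l g) (s : seq 'I_g) r a e x :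
  (forall i j, (i < size s)%N -> Y (a + i)%N j = rc (if j == nth j s i then e else 0) *: 1%:M) ->
  ymul Y f (size s + r) a x =
  rc (e ^+ size s) *: ymul Y (fun w => f (s ++ w)) r (a + size s) x.
Proof.
elim: s f a => [|i s ih] f a hY; first by rewrite expr0 scale1r addn0.
rewrite /= addSn ymulS (bigD1 i) //= big1 ?addr0 => [|j ji]; last first.
  have := hY 0%N j isT; rewrite addn0 /= (negbTE ji) => ->.
  by rewrite scale0r trmx0 mulmx0.
have := hY 0%N i isT; rewrite addn0 /= eqxx => ->.
rewrite linearZ /= trmx1 -scalemxAr mulmx1 ih; last first.
  by move=> b j bs; rewrite addSnnS hY.
by rewrite scalerA -rcM -exprS addSnnS.
Qed.

End Chain.

(** * Contractions built from higher coefficients *)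

Section Coefficients.
Variable R : realType.
Local Notation C := (Cplx R).

Lemma pencil_nrm d' d g (L : pencil R d' d g) n (X : mxtuple R g n) :
  opnorm (pencil_eval L X) = nrm L (fun j => (X j)^T).
Proof.
rewrite nrm.unlock; congr (opnorm _); rewrite /pencil_eval.
by apply: eq_bigr => j _; rewrite trmxK.
Qed.

(** Norms are homogeneous: if the inequality failed, dividing [X] by a value strictly between the
    two norms would contradict the hypothesis. *)
Lemma nrm_le_ball p' p l' l g (L : 'I_g -> 'M[C]_(p', p)) (M : 'I_g -> 'M[C]_(l', l)) :
  (forall n (X : 'I_g -> 'M[C]_n), nrm L X < 1 -> nrm M X <= 1) ->
  forall n (X : 'I_g -> 'M[C]_n), nrm M X <= nrm L X.
Proof.
move=> h n X; rewrite leNgt; apply/negP => lt.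
have [lc cM] := midf_lt lt; move: ((_ + _) / _) lc cM => c lc cM.
have c0 : 0 < c := le_lt_trans (nrm_ge0 L X) lc.
have cn : c^-1 != 0 by rewrite invr_eq0 gt_eqF.
have := h n (fun j => rc c^-1 *: X j).
rewrite !nrm_scale // ger0_norm ?invr_ge0 ?(ltW c0) // => {}h.
have : c^-1 * nrm M X <= 1 by apply: h; rewrite ltr_pdivrMl // mulr1.
by rewrite ler_pdivrMl // mulr1 leNgt cM.
Qed.

(** Hilbert-Schmidt norms of the coefficients bound the action uniformly in [n]; the value [2^-1]
    keeps these tuples strictly inside the ball. *)
Lemma letter_bound p' p g (L : 'I_g -> 'M[C]_(p', p)) : exists2 e, 0 < e &
  forall n (i : 'I_g), nrm L (fun j => rc (if j == i then e else 0) *: (1%:M : 'M[C]_n)) <= 2^-1.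
Proof.
pose S := \sum_j n2 (L j).
have S0 : 0 <= S by apply: sumr_ge0 => j _; exact: n2_ge0.
exists (2^-1 / (1 + S)).
  by rewrite divr_gt0 ?invr_gt0 ?ltr0n // ltr_pwDl.
move=> n i; apply: nrm_le => [|u]; first by rewrite invr_ge0 ler0n.
set e := _ / _.
have -> : act L (fun j => rc (if j == i then e else 0) *: 1%:M) u = rc e *: (L i *m u).
  rewrite /act (bigD1 i) //= eqxx big1 ?addr0 => [|j /negbTE ->].
    by rewrite -scalemxAr mulmx1.
  by rewrite scale0r mulmx0.
rewrite n2Z; have Si : n2 (L i) <= S.
  rewrite /S (bigD1 i) //= lerDl; apply: sumr_ge0 => j _; exact: n2_ge0.
have h : n2 (L i *m u) <= (1 + S) ^+ 2 * n2 u.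
  apply: le_trans (n2_mulmx _ _) _; apply: ler_wpM2r; first exact: n2_ge0.
  apply: le_trans Si _; rewrite expr2 mulrDl mul1r.
  by rewrite (@le_trans _ _ (1 + S)) ?lerDl ?lerDr ?ler01 // mulr_ge0 // addr_ge0.
have -> : 2^-1 ^+ 2 * n2 u = e ^+ 2 * ((1 + S) ^+ 2 * n2 u).
  rewrite mulrA -exprMn /e divfK // gt_eqF // ltr_pwDl //.
by apply: ler_wpM2l h; exact: sqr_ge0.
Qed.

Section Contraction.
Variables (d' d g l' l : nat) (L : pencil R d' d g) (f : fps R l' l g).
Hypothesis fc : contraction_valued L f.

Lemma chain_contraction k n (Y : nat -> 'I_g -> 'M[C]_n) c :
  0 <= c -> c < 1 -> (forall i, (i < k)%N -> nrm L (fun j => (Y i j)^T) <= c) ->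
  forall u, n2 (\sum_(m < k.+1) hom f (chain k Y) m u) <= n2 u.
Proof.
move=> c0 c1 hc u.
have : opnorm (fps_eval f (chain k Y)) <= 1.
  apply: fc; rewrite /pball /= pencil_nrm; apply: le_lt_trans c1.
  exact: nrm_chain_le.
move=> o1; have := opnorm_ub (fps_eval f (chain k Y)) (cv u).
rewrite fps_eval_chain_cv !n2_cv => h; apply: le_trans h _.
rewrite -[leRHS]mul1r; apply: ler_wpM2r; first exact: n2_ge0.
by rewrite expr_le1 // opnorm_ge0.
Qed.

Lemma n2_slots k n m (z : 'M[C]_(m, k.+1 * n)) a b : (a <= k)%N -> (b <= k)%N -> a != b ->
  n2 (z *m (slot R n k a)^T) + n2 (z *m (slot R n k b)^T) <= n2 z.
Proof.
move=> ak bk ab; rewrite (n2_resolution z) (bigD1 (inord a)) //= lerD2l.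
rewrite (bigD1 (inord b)) /=; last by rewrite -val_eqE /= !inordK // eq_sym.
by rewrite lerDl; apply: sumr_ge0 => i _; exact: n2_ge0.
Qed.

Lemma n2_slot_le k n m (z : 'M[C]_(m, k.+1 * n)) a : n2 (z *m (slot R n k a)^T) <= n2 z.
Proof.
rewrite (n2_resolution z) (bigD1 (inord a)) //= lerDl.
by apply: sumr_ge0 => i _; exact: n2_ge0.
Qed.

Lemma n2_mulslot k n m (y : 'M[C]_(m, n)) b : (b <= k)%N -> n2 (y *m slot R n k b) = n2 y.
Proof.
move=> bk; rewrite /n2 rdot_mulr /slot -inc_tr -mulmxA -/(slot R n k b) slot_mul //.
by rewrite eqxx mulmx1.
Qed.

Definition lin : 'I_g -> 'M[C]_(l', l) := fun j => f [:: j].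

Lemma trK n (X : 'I_g -> 'M[C]_n) : (fun j => ((X j)^T)^T) = X.
Proof. by apply: funext => j; rewrite trmxK. Qed.

(** A chain of length one sees only the coefficients of degree 0 and 1; block 0 of the image of
    block 1 isolates the linear ones. *)
Lemma lin_contraction n (X : 'I_g -> 'M[C]_n) x : nrm L X < 1 -> n2 (act lin X x) <= n2 x.
Proof.
move=> X1; pose Y (i : nat) j := (X j)^T.
have := @chain_contraction 1 n Y _ (nrm_ge0 L X) X1.
rewrite /Y trK => /(_ (fun _ _ => lexx _)) h.
have := h (x *m slot R n 1 1); rewrite n2_mulslot //; apply: le_trans.
have := n2_slot_le (\sum_(m < 2) hom f (chain 1 Y) m (x *m slot R n 1 1)) 0.
by rewrite sum_hom_slot // ymul1 /Y trK.
Qed.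

Lemma nrm_lin_le n (X : 'I_g -> 'M[C]_n) : nrm lin X <= nrm L X.
Proof.
apply: nrm_le_ball => m Z Z1; apply: nrm_le ler01 _ => u.
by rewrite expr1n mul1r; exact: lin_contraction.
Qed.

Section Letters.
Variables (e : R) (s : seq 'I_g).
Hypothesis eL : forall n (i : 'I_g),
  nrm L (fun j => rc (if j == i then e else 0) *: (1%:M : 'M[C]_n)) <= 2^-1.
Hypothesis s0 : (0 < size s)%N.

Definition letter n a (j : 'I_g) : 'M[C]_n := rc (if j == nth j s a then e else 0) *: 1%:M.

Lemma nrm_letter n a : (a < size s)%N -> nrm L (fun j => (letter n a j)^T) <= 2^-1.
Proof.
(* The default of [nth] in [letter] varies with [j]; a fixed letter [i0] replaces it. *)
move=> as'; have [i0 _] : exists i : 'I_g, True by case: s as' => // i ?; exists i.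
have -> : (fun j => (letter n a j)^T) =
    fun j => rc (if j == nth i0 s a then e else 0) *: (1%:M : 'M[C]_n).
  by apply: funext => j; rewrite /letter linearZ /= trmx1 (set_nth_default i0).
exact: eL.
Qed.

Lemma half_max (x : R) : x < 1 -> Order.max x 2^-1 < 1.
Proof. by move=> x1; rewrite gt_max x1 invf_lt1 ?ltr1n ?ltr0n. Qed.

(** The chain consists of the letters of [s] followed by [X]. Its last block reaches block [size s]
    through the linear part and block 0 through the words [s ++ [:: j]]; these outputs are
    orthogonal, so their squared norms add. *)
Lemma col_contraction n (X : 'I_g -> 'M[C]_n) x : nrm L X < 1 ->
  n2 (act lin X x) + n2 (rc (e ^+ size s) *: act (fun j => f (s ++ [:: j])) X x) <= n2 x.
Proof.
move=> X1; pose m := size s.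
pose Y (a : nat) j := if (a < m)%N then letter n a j else (X j)^T.
have hY i : (i < m.+1)%N -> nrm L (fun j => (Y i j)^T) <= Order.max (nrm L X) 2^-1.
  move=> _; rewrite /Y; case: ltnP => [im|_].
    by rewrite le_max nrm_letter ?orbT.
  by rewrite trK le_max lexx.
have c0 : 0 <= Order.max (nrm L X) 2^-1 by rewrite le_max nrm_ge0.
have := chain_contraction c0 (half_max X1) hY (x *m slot R n m.+1 m.+1).
rewrite n2_mulslot // => h; apply: le_trans h.
have := @n2_slots m.+1 n _ (\sum_(a < m.+2) hom f (chain m.+1 Y) a (x *m slot R n m.+1 m.+1)) m 0.
rewrite !sum_hom_slot // subSn // subnn subn0 => /(_ (leqnSn m) isT) h.
have {}h := h (lt0n_neq0 s0); apply: le_trans h; rewrite ymul1 -addn1.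
rewrite (@ymul_scalar _ _ _ _ _ _ _ s 1 0 e); last first.
  by move=> i j im; rewrite add0n /Y im.
by rewrite add0n ymul1 /Y ltnn trK.
Qed.

(** Here [X] comes first. Block 1 reaches block 0 through the linear part and the last block reaches
    it through the words [j :: s], so two orthogonal inputs share one output. *)
Lemma row_contraction n (X : 'I_g -> 'M[C]_n) x y : nrm L X < 1 ->
  n2 (act lin X x + rc (e ^+ size s) *: act (fun j => f (j :: s)) X y) <= n2 x + n2 y.
Proof.
move=> X1; pose m := size s.
pose Y (a : nat) j := if a is a'.+1 then letter n a' j else (X j)^T.
have hY i : (i < m.+1)%N -> nrm L (fun j => (Y i j)^T) <= Order.max (nrm L X) 2^-1.
  case: i => [_|i im]; first by rewrite trK le_max lexx.
  by rewrite le_max nrm_letter ?orbT.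
have c0 : 0 <= Order.max (nrm L X) 2^-1 by rewrite le_max nrm_ge0.
have := chain_contraction c0 (half_max X1) hY
  (x *m slot R n m.+1 1 + y *m slot R n m.+1 m.+1).
have -> : n2 (x *m slot R n m.+1 1 + y *m slot R n m.+1 m.+1) = n2 x + n2 y.
  rewrite n2D !n2_mulslot // rdot_mulr -mulmxA /slot -inc_tr -/(slot R n m.+1 1).
  rewrite -/(slot R n m.+1 m.+1) slot_mul // ifF ?mulmx0 ?rdot0r ?mulr0 ?addr0 //.
  by apply/negbTE; rewrite eqSS -lt0n.
apply: le_trans.
set z := \sum_(_ < _) _.
have := n2_slot_le z 0.
have -> : z = \sum_(a < m.+2) hom f (chain m.+1 Y) a (x *m slot R n m.+1 1) +
   \sum_(a < m.+2) hom f (chain m.+1 Y) a (y *m slot R n m.+1 m.+1).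
  by rewrite /z -big_split; apply: eq_bigr => a _; rewrite homD.
rewrite mulmxDl sum_hom_slot // sum_hom_slot // !subn0 ymul1 ymulS {1}/Y trK.
rewrite (eq_bigr (fun j => rc (e ^+ m) *: (f (j :: s) *m y *m X j))); last first.
  move=> j _; rewrite -[m in ymul _ _ m]addn0.
  rewrite (@ymul_scalar _ _ _ _ _ _ _ s 0 1 e) => [|i i' im]; last by rewrite add1n.
  by rewrite ymul0 cats0 /Y trmxK -scalemxAl.
by rewrite -scaler_sumr.
Qed.

End Letters.
End Contraction.
End Coefficients.

(** * Pencil ball maps *)

Section BallMaps.
Variable R : realType.
Local Notation C := (Cplx R).
Local Notation "A *t B" := (mxtens.tensmx A B) (at level 40, left associativity).

(** * Vanishing of the higher coefficients along the summand *)

Section Kill.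
Variables (d' d p' p g l' l : nat) (L : pencil R d' d g) (Lt : 'I_g -> 'M[C]_(p', p)).
Variables (f : fps R l' l g).
Hypotheses (p'0 : (0 < p')%N) (p0 : (0 < p)%N).
Hypothesis LtL : forall n (X : 'I_g -> 'M[C]_n), nrm Lt X = nrm L X.
Hypothesis Ltmin : forall a b (K : 'I_g -> 'M[C]_(a, b)),
  (forall n (X : 'I_g -> 'M[C]_n), nrm K X = nrm Lt X) -> (p' * p <= a * b)%N.
Hypothesis fc : contraction_valued L f.
Variables (A : 'M[C]_(l', p')) (B : 'M[C]_(l, p)).
Hypothesis fAB : summand (lin f) Lt A B.

Lemma n2_isor m n k (u : 'M[C]_(m, n)) (D : 'M[C]_(n, k)) :
  D *m D^t* = 1%:M -> n2 (u *m D) = n2 u.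
Proof. by move=> h; rewrite /n2 rdot_mulr -mulmxA h mulmx1. Qed.

(** The stacked pencil [M] has the norms of [Lt], hence contains [Lt] as a summand. As [M j] has [p]
    columns, the isometry [B'] is unitary, so [M j] and [Lt j] have equal Hilbert-Schmidt norms and
    the lower block of [M j] is zero. *)
Lemma coef_right0 s j : (0 < size s)%N -> f (s ++ [:: j]) *m B = 0.
Proof.
move=> s0; case: (fAB) => AA BB LB _.
have [e e0 eL] := letter_bound L.
pose c := e ^+ size s; have c0 : c != 0 by rewrite expf_neq0 // gt_eqF.
pose h j := f (s ++ [:: j]).
pose M j := col_mx (lin f j *m B) (rc c *: (h j *m B)).
have actM n (X : 'I_g -> 'M[C]_n) y :
    n2 (act M X y) = n2 (act (lin f) X (B *m y)) + n2 (rc c *: act h X (B *m y)).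
  rewrite -n2_col; congr n2; rewrite /act scaler_sumr.
  rewrite (eq_bigr (fun j => col_mx (lin f j *m (B *m y) *m X j) (rc c *: (h j *m (B *m y) *m X j)))).
    elim: (index_enum _) => [|i r ih]; first by rewrite !big_nil col_mx0.
    by rewrite !big_cons ih add_col_mx.
  by move=> i _; rewrite /M !mul_col_mx !mulmxA -!scalemxAl.
have ML n (X : 'I_g -> 'M[C]_n) : nrm M X = nrm Lt X.
  apply/eqP; rewrite eq_le; apply/andP; split.
    rewrite LtL; apply: nrm_le_ball => n' Z Z1; apply: nrm_le ler01 _ => y.
    rewrite expr1n mul1r actM -(n2_isoml y BB).
    exact: (col_contraction fc eL s0).
  apply: nrm_le (nrm_ge0 _ _) _ => y.
  apply: le_trans (nrm_ub M X y); rewrite actM (act_mull X y LB) (n2_isoml _ AA) lerDl.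
  exact: n2_ge0.
have [A' [B' [AA' BB' MB _]]] := minimal_summand p'0 p0 Ltmin ML.
have e1 : n2 (M j) = n2 (Lt j).
  by rewrite -(n2_isor (M j) (mulmx1C BB')) MB (n2_isoml _ AA').
move: e1; rewrite /M n2_col LB (n2_isoml _ AA) n2Z.
rewrite -[RHS]addr0 => /addrI /eqP.
by rewrite mulf_eq0 expf_eq0 /= (negbTE c0) /= => /eqP /n2_eq0.
Qed.

(** The dual argument: the higher coefficients stand beside the linear ones, and now [A'] is square
    and therefore unitary. *)
Lemma coef_left0 s j : (0 < size s)%N -> A^t* *m f (j :: s) = 0.
Proof.
move=> s0; case: (fAB) => AA BB LB LA.
have [e e0 eL] := letter_bound L.
pose c := e ^+ size s; have c0 : c != 0 by rewrite expf_neq0 // gt_eqF.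
pose h j := f (j :: s).
pose M j := row_mx (A^t* *m lin f j) (rc c *: (A^t* *m h j)).
have actM n (X : 'I_g -> 'M[C]_n) x y :
    act M X (col_mx x y) = A^t* *m (act (lin f) X x + rc c *: act h X y).
  rewrite mulmxDr -scalemxAr /act !mulmx_sumr scaler_sumr -big_split.
  by apply: eq_bigr => i _; rewrite /M mul_row_col mulmxDl -!scalemxAl !mulmxA.
have ALt i : A^t* *m lin f i = Lt i *m B^t*.
  by rewrite -[LHS]adj_adj adj_mul adj_adj LA adj_mul adj_adj.
have ML n (X : 'I_g -> 'M[C]_n) : nrm M X = nrm Lt X.
  apply/eqP; rewrite eq_le; apply/andP; split.
    rewrite LtL; apply: nrm_le_ball => n' Z Z1; apply: nrm_le ler01 _ => u.
    rewrite expr1n mul1r -[u]vsubmxK actM n2_col; apply: le_trans (n2_coisom _ AA) _.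
    exact: (row_contraction fc eL s0).
  apply: nrm_le (nrm_ge0 _ _) _ => y.
  have := nrm_ub M X (col_mx (B *m y) 0); rewrite actM n2_col n20 addr0 (n2_isoml _ BB).
  rewrite (act_mull X y LB) (_ : act h X 0 = 0) ?scaler0 ?addr0.
    by rewrite mulmxA AA mul1mx.
  by rewrite /act big1 // => i _; rewrite mulmx0 mul0mx.
have [A' [B' [AA' BB' _ MA]]] := minimal_summand p'0 p0 Ltmin ML.
have n2_adj m n (u : 'M[C]_(m, n)) : n2 (u^t*) = n2 u by exact: rdot_adj.
have e1 : n2 (M j) = n2 (Lt j).
  by rewrite -(n2_adj _ _ (M j)) -(n2_isor _ (mulmx1C AA')) MA (n2_isoml _ BB') n2_adj.
move: e1; rewrite /M n2_row ALt n2Z -(n2_adj _ _ (Lt j *m _)) adj_mul adj_adj.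
rewrite (n2_isoml _ BB) n2_adj -[RHS]addr0 => /addrI /eqP.
by rewrite mulf_eq0 expf_eq0 /= (negbTE c0) /= => /eqP /n2_eq0.
Qed.

End Kill.

Lemma normc_expi (t : R) : ComplexField.Normc.normc (expi t) = 1.
Proof. by rewrite /expi /= cos2Dsin2 sqrtr1. Qed.

Lemma opnorm_rot m n (A : 'M[C]_(m, n)) (t : R) : opnorm (expi t *: A) <= opnorm A.
Proof.
apply: opnorm_le (opnorm_ge0 _) _ => v.
by rewrite -scalemxAl n2Zc normc_expi expr1n mul1r opnorm_ub.
Qed.

Lemma chain_scale g n k (Y : nat -> 'I_g -> 'M[C]_n) (z : C) :
  z *: chain k Y = chain k (fun i j => z *: Y i j).
Proof.
apply/ffunP => j; rewrite !ffunE scaler_sumr; apply: eq_bigr => i _.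
by rewrite -scalemxAr -scalemxAl.
Qed.

Lemma homog1 l' l g (f : fps R l' l g) n (X : mxtuple R g n) :
  fps_homog_eval f X 1 = pencil_eval ([ffun j => lin f j] : pencil R l' l g) X.
Proof.
rewrite /fps_homog_eval /pencil_eval (reindex (fun j : 'I_g => [tuple j])) /=.
  by apply: eq_bigr => j _; rewrite ffunE /word_eval big_cons big_nil mulr1.
exists (fun w : 1.-tuple 'I_g => thead w) => [j _|w _]; first by rewrite theadE.
by case/tupleP: w => j w; apply: val_inj; rewrite (tuple0 w) /= theadE.
Qed.

Lemma pencil_evalZ d' d g (L : pencil R d' d g) n (X : mxtuple R g n) (z : C) :
  pencil_eval L (z *: X) = z *: pencil_eval L X.
Proof.
rewrite /pencil_eval scaler_sumr; apply: eq_bigr => j _; rewrite ffunE.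
by apply/matrixP => a b; rewrite !mxE mulrCA.
Qed.

Lemma fps_eval_chain1 l' l g (f : fps R l' l g) n (Y : nat -> 'I_g -> 'M[C]_n) :
  f [::] = 0 -> fps_eval f (chain 1 Y) =
  pencil_eval ([ffun j => lin f j] : pencil R l' l g) (chain 1 Y).
Proof.
move=> f0; case: (fps_eval_chain 1 Y f) => _ ->.
rewrite big_ord_recl big_ord1 /= homog1 [X in X + _](_ : _ = 0) ?add0r //.
rewrite /fps_homog_eval big1 // => w _; rewrite (tuple0 w) f0.
exact: mxtens.tens0mx.
Qed.

(** On a chain of length one [f] equals its linear part, as [f [::] = 0] and longer words vanish. A
    boundary value of norm 1 then bounds the linear part at a normalised tuple from below. *)
Lemma nrm_lin_ball_map d' d g l' l (L : pencil R d' d g) (f : fps R l' l g) :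
  pencil_ball_map L f -> f [::] = 0 ->
  forall n (X : 'I_g -> 'M[C]_n), nrm (lin f) X = nrm L X.
Proof.
move=> [_ fc fb] f0 n X; apply/eqP; rewrite eq_le (nrm_lin_le fc) /=.
have [->|N0] := eqVneq (nrm L X) 0; first exact: nrm_ge0.
have Npos : 0 < nrm L X by rewrite lt_def N0 nrm_ge0.
pose Z j := rc (nrm L X)^-1 *: X j.
have cn : (nrm L X)^-1 != 0 by rewrite invr_eq0.
have Z1 : nrm L Z = 1 by rewrite nrm_scale // ger0_norm ?invr_ge0 ?nrm_ge0 // mulVf.
suff : 1 <= nrm (lin f) Z.
  by rewrite nrm_scale // ger0_norm ?invr_ge0 ?nrm_ge0 // ler_pdivlMl // mulr1.
pose Y (i : nat) j := (Z j)^T.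
have YK i : (fun j => (Y i j)^T) = Z by apply: funext => j; rewrite /Y trmxK.
have bd : pball_boundary L (2 * n) (chain 1 Y).
  rewrite /pball_boundary /= pencil_nrm; apply/eqP; rewrite eq_le; apply/andP; split.
    by apply: nrm_chain_le => // i _; rewrite YK Z1.
  by have := nrm_chain_ge Y L (ltn0Sn 0); rewrite YK Z1.
(* The line has positive Lebesgue measure, so what holds almost everywhere holds at some [t]. *)
have [t [D bv D1]] : exists t, exists2 D, boundary_value f (chain 1 Y) t D & opnorm D = 1.
  have pos : (0 < (@lebesgue_measure R) [set: R])%E.
    by rewrite -set_itvNyy lebesgue_measure_itv /= ltry.
  have pf := ae_properfilter_algebraOfSetsType pos.
  exact: (@filter_ex _ _ pf _ (fb _ _ bd)).
set G := pencil_eval ([ffun j => lin f j] : pencil R l' l g) (chain 1 Y).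
(* The radial function is exactly [r |-> rc r *: (expi t *: G)], so its limit is its value at
   [r = 1]. *)
have DE : D = expi t *: G.
  have cG : continuous (fun r : R => rc r *: (expi t *: G)).
    apply: mx_continuous; apply: mcontZ; first exact: id_cont.
    exact: mcont_cst.
  apply: (cvg_unique _ bv); first exact: norm_hausdorff.
  have -> : (fun r : R => fps_eval f ((rc r * expi t) *: chain 1 Y)) =
      (fun r : R => rc r *: (expi t *: G)).
    apply: funext => r; rewrite chain_scale fps_eval_chain1 // -chain_scale.
    by rewrite pencil_evalZ scalerA.
  have := cvg_at_left_filter (cG 1); rewrite scale1r; exact.
have : 1 <= opnorm G by rewrite -D1 DE opnorm_rot.
move=> /le_trans; apply; rewrite /G pencil_nrm.
have -> : ([ffun j => lin f j] : pencil R l' l g) = lin f :> ('I_g -> _).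
  by apply: funext => j; rewrite ffunE.
by apply: nrm_chain_le (nrm_ge0 _ _) _ => i _; rewrite YK.
Qed.

Lemma tens1_isom p q n (A : 'M[C]_(p, q)) m (v : 'M[C]_(q * n, m)) : A^t* *m A = 1%:M ->
  n2 ((A *t (1%:M : 'M[C]_n)) *m v) = n2 v.
Proof.
move=> AA; rewrite !(n2_cols _); apply: eq_bigr => j _.
rewrite colE -mulmxA -colE -[col j v]uncvK tens_cv !n2_cv trmx1 mulmx1.
exact: n2_isoml.
Qed.

Lemma tens1_coisom p q n (A : 'M[C]_(p, q)) m (v : 'M[C]_(p * n, m)) : A^t* *m A = 1%:M ->
  n2 ((A^t* *t (1%:M : 'M[C]_n)) *m v) <= n2 v.
Proof.
move=> AA; rewrite !(n2_cols _); apply: ler_sum => j _.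
rewrite colE -mulmxA -colE -[col j v]uncvK tens_cv !n2_cv trmx1 mulmx1.
exact: n2_coisom.
Qed.

(** * Compression of a power series by isometries *)

Section Compression.
Variables (d' d g l' l m' m : nat) (L : pencil R d' d g) (f : fps R l' l g).
Variables (P : 'M[C]_(l', m')) (Q : 'M[C]_(l, m)).
Hypotheses (PP : P^t* *m P = 1%:M) (QQ : Q^t* *m Q = 1%:M).
Hypotheses (fa : analytic_on_pball L f) (fc : contraction_valued L f).

Definition compress : fps R m' m g := fun w => P^t* *m f w *m Q.

Lemma homog_compress n (X : mxtuple R g n) k : fps_homog_eval compress X k =
  (P^t* *t 1%:M) *m fps_homog_eval f X k *m (Q *t 1%:M).
Proof.
rewrite /fps_homog_eval mulmx_sumr mulmx_suml; apply: eq_bigr => w _.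
by rewrite !mxtens.tensmx_mul mul1mx mulmx1.
Qed.

Lemma cvg_compress n (X : mxtuple R g n) : pball L n X ->
  series (fps_homog_eval compress X) @ \oo -->
  (P^t* *t 1%:M) *m fps_eval f X *m (Q *t 1%:M).
Proof.
move=> /fa fX.
have -> : series (fps_homog_eval compress X) =
    (fun F => (P^t* *t 1%:M) *m F *m (Q *t 1%:M)) \o series (fps_homog_eval f X).
  apply: funext => N /=; rewrite /series /= mulmx_sumr mulmx_suml.
  by apply: eq_bigr => k _; exact: homog_compress.
have hc : continuous (fun F : 'M[C]_(l' * n, l * n) =>
    (P^t* *t (1%:M : 'M[C]_n)) *m F *m (Q *t (1%:M : 'M[C]_n))).
  apply: mx_continuous; apply: mcontM; last exact: mcont_cst.
  by apply: mcontM; [exact: mcont_cst|apply: mcont_proj; exact: id_cont].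
exact: (cvg_comp _ _ fX (hc _)).
Qed.

Lemma analytic_compress : analytic_on_pball L compress.
Proof. by move=> n X /cvg_compress h; apply/cvg_ex; eexists; exact: h. Qed.

Lemma contraction_compress : contraction_valued L compress.
Proof.
move=> n X X1; rewrite /fps_eval (cvg_lim _ (cvg_compress X1)); last exact: norm_hausdorff.
apply: opnorm_le ler01 _ => v; rewrite expr1n mul1r -!mulmxA.
apply: le_trans (tens1_coisom _ PP) _; rewrite -(tens1_isom v QQ).
apply: le_trans (opnorm_ub _ _) _; rewrite -[leRHS]mul1r; apply: ler_wpM2r; first exact: n2_ge0.
by rewrite expr_le1 // ?opnorm_ge0 // fc.
Qed.

End Compression.

(** [D] is an orthonormal basis of the orthogonal complement of the range of [A], taken from the
    left kernel of [A]; a rank count gives it [m] columns. *)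
Lemma isom_complete p m (A : 'M[C]_(p + m, p)) : A^t* *m A = 1%:M ->
  exists D : 'M[C]_(p + m, m), [/\ D^t* *m D = 1%:M, A^t* *m D = 0 &
    row_mx A D *m (row_mx A D)^t* = 1%:M].
Proof.
move=> AA.
have rA : \rank A = p.
  apply/eqP; rewrite eqn_leq rank_leq_col /=.
  by have := mxrankM_maxr (A^t*) A; rewrite AA mxrank1.
have [r [D [h [h' [DD kD hh']]]]] := isom_factor ((kermx A)^t*).
have rm : r = m.
  have : \rank (D *m h) = m by rewrite -kD mxrank_adj mxrank_ker rA addKn.
  move=> <-; apply/eqP; rewrite eqn_leq; apply/andP; split; last first.
    exact: leq_trans (mxrankM_maxr _ _) (rank_leq_row _).
  have := mxrankM_maxl (D^t* *m (D *m h)) h'.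
  rewrite (mulmxA (D^t*)) DD mul1mx hh' mxrank1 => /leq_trans; apply.
  by rewrite -[X in (\rank X <= _)%N](mul1mx h) -DD -mulmxA mxrankM_maxr.
subst r; exists D.
have AD : A^t* *m D = 0.
  have : A^t* *m (D *m h) = 0 by rewrite -kD -adj_mul mulmx_ker adj0.
  by move=> e; rewrite -[LHS]mulmx1 -hh' mulmxA -(mulmxA (A^t*)) e mul0mx.
split=> //; apply: mulmx1C; rewrite adj_row mul_col_row AA DD AD.
by rewrite -[D^t* *m A]adj_adj adj_mul adj_adj AD adj0 -scalar_mx_block.
Qed.

End BallMaps.

(** * Translation between pencil balls and norms *)

Section Balls.
Variable R : realType.
Local Notation C := (Cplx R).

Lemma pball_nrm d' d g (L : pencil R d' d g) n (X : 'I_g -> 'M[C]_n) :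
  nrm L X < 1 <-> pball L n ([ffun j => (X j)^T] : mxtuple R g n).
Proof.
rewrite /pball /= pencil_nrm.
suff -> : (fun j => (([ffun j => (X j)^T] : mxtuple R g n) j)^T) = X by [].
by apply: funext => j; rewrite ffunE trmxK.
Qed.

Lemma same_pball_nrm d1' d1 d2' d2 g (L1 : pencil R d1' d1 g) (L2 : pencil R d2' d2 g) :
  same_pball L1 L2 -> forall n (X : 'I_g -> 'M[C]_n), nrm L1 X = nrm L2 X.
Proof.
move=> h n X; apply/eqP; rewrite eq_le; apply/andP; split; move: n X.
  by apply: nrm_le_ball => n X /pball_nrm; rewrite -h => /pball_nrm /ltW.
by apply: nrm_le_ball => n X /pball_nrm; rewrite h => /pball_nrm /ltW.
Qed.

Lemma nrm_same_pball d1' d1 d2' d2 g (L1 : pencil R d1' d1 g) (L2 : pencil R d2' d2 g) :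
  (forall n (X : 'I_g -> 'M[C]_n), nrm L1 X = nrm L2 X) -> same_pball L1 L2.
Proof.
by move=> h n; apply/seteqP; split=> X; rewrite /pball /= !pencil_nrm h.
Qed.

Lemma pencil_eval0 d' d g (L : pencil R d' d g) n (X : mxtuple R g n) :
  pencil_eval L X = 0 <-> nrm L (fun j => (X j)^T) <= 0.
Proof.
rewrite -pencil_nrm; split=> [->|h].
  by apply: opnorm_le => // v; rewrite mul0mx n20 expr0n mul0r.
have h0 (v : 'cV[C]_(d * n)) : pencil_eval L X *m v = 0.
  apply: n2_eq0; apply/eqP; rewrite eq_le n2_ge0 andbT.
  apply: le_trans (opnorm_ub _ _) _.
  have -> : opnorm (pencil_eval L X) = 0.
    by apply/eqP; rewrite eq_le h opnorm_ge0.
  by rewrite expr0n mul0r.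
apply/matrixP => i j; have := h0 (delta_mx j 0).
by rewrite -colE => /colP /(_ i); rewrite !mxE.
Qed.

(** A pencil without rows or without columns vanishes at the nonzero tuple of identities of size
    1. *)
Lemma nondegenerate_pos d' d g (L : pencil R d' d g) : (0 < g)%N ->
  nondegenerate_pencil L -> (0 < d')%N /\ (0 < d)%N.
Proof.
move=> hg nd; pose X : mxtuple R g 1 := [ffun=> 1%:M].
have X0 : X <> 0.
  move=> /ffunP /(_ (Ordinal hg)); rewrite !ffunE => /matrixP /(_ 0 0) /eqP.
  by rewrite !mxE oner_eq0.
split; rewrite lt0n; apply/eqP => d0; subst; apply: X0; apply: nd.
  by apply/matrixP => -[].
by apply/matrixP => i [].
Qed.

Lemma minimal_nrm p' p g (Lt : pencil R p' p g) : minimal_defining_pencil Lt ->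
  forall a b (K : 'I_g -> 'M[C]_(a, b)),
  (forall n (X : 'I_g -> 'M[C]_n), nrm K X = nrm Lt X) -> (p' * p <= a * b)%N.
Proof.
move=> [nd min] a b K h; pose K' : pencil R a b g := [ffun j => K j].
have K'K : (K' : 'I_g -> 'M[C]_(a, b)) = K by apply: funext => j; rewrite ffunE.
have K'Lt n (X : 'I_g -> 'M[C]_n) : nrm K' X = nrm Lt X by rewrite K'K h.
apply: (min _ _ K'); last exact: nrm_same_pball.
by move=> n X /pencil_eval0; rewrite K'Lt => /pencil_eval0; apply: nd.
Qed.

(** The zero tuple is a chain of length 0, on which [f] multiplies by its constant coefficient; at
    matrix size [l] the identity is available as input. *)
Lemma constant_coef0 l' l g (f : fps R l' l g) :
  (forall n : nat, fps_eval f (0 : mxtuple R g n) = 0) -> f [::] = 0.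
Proof.
move=> h; pose Y (i : nat) (j : 'I_g) : 'M[C]_l := 0.
have e : chain 0 Y = 0 by apply/ffunP => j; rewrite !ffunE big_ord0.
have := sum_hom_slot Y f (1%:M : 'M[C]_l) (leqnn 0) (leqnn 0).
rewrite subnn ymul0 mulmx1 => <-.
rewrite -[\sum_(m < 1) _]cvK -fps_eval_chain_cv e h mul0mx.
suff -> : uncv (0 : 'cV[C]_(l' * (1 * l))) = 0 by rewrite mul0mx.
by apply/matrixP => i j; rewrite !mxE.
Qed.

End Balls.

(** * Assembly of the block decomposition *)

Theorem theorem1p3 (R : realType) (g d' d p' p l' l : nat) (hg : (0 < g)%N)
    (L : pencil R d' d g) (Lt : pencil R p' p g) (f : fps R l' l g)
    (hL : nondegenerate_pencil L)
    (hLt : minimal_defining_pencil_for L Lt)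
    (hf : pencil_ball_map L f)
    (hf0 : forall n : nat, fps_eval f (0 : mxtuple R g n) = 0) :
  exists (m' m : nat) (el' : (p' + m')%N = l') (el : (p + m)%N = l)
      (U : 'M[Cplx R]_l') (V : 'M[Cplx R]_l) (ft : fps R m' m g),
    [/\ U \is unitarymx,
        V \is unitarymx,
        analytic_on_pball L ft,
        contraction_valued L ft &
        forall w : seq 'I_g,
          f w = U *m castmx (el', el) (block_mx (pencil_fps Lt w) 0 0 (ft w))
                  *m V^t*].
Proof.
have f0 := constant_coef0 hf0.
case: hLt => minLt LtL.
have [p'0 p0] := nondegenerate_pos hg (proj1 minLt).
have {}LtL := same_pball_nrm LtL.
have Ltmin := minimal_nrm minLt.
have fL := nrm_lin_ball_map hf f0.
have fLt n (X : 'I_g -> 'M[Cplx R]_n) : nrm (lin f) X = nrm Lt X by rewrite fL LtL.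
have [A [B fAB]] := minimal_summand p'0 p0 Ltmin fLt.
case: hf => fa fc _; case: (fAB) => AA BB fB fA.
have right0 := coef_right0 p'0 p0 LtL Ltmin fc fAB.
have left0 := coef_left0 p'0 p0 LtL Ltmin fc fAB.
have [m' el'] : exists m', (p' + m')%N = l' by exists (l' - p')%N; rewrite subnKC ?(isom_dim AA).
have [m el] : exists m, (p + m)%N = l by exists (l - p)%N; rewrite subnKC ?(isom_dim BB).
exists m', m, el', el; subst l' l.
have [D [DD AD UD]] := isom_complete AA; have [E [EE BE VE]] := isom_complete BB.
exists (row_mx A D), (row_mx B E), (compress f D E); split.
- exact/unitarymxP.
- exact/unitarymxP.
- exact: analytic_compress.
- exact: contraction_compress.
move=> w; rewrite castmx_id.
(* The blocks of [f w] are computed in the orthonormal bases [row_mx A D] and [row_mx B E], for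
   words of length 0, 1 and at least 2. *)
have -> : block_mx (pencil_fps Lt w) 0 0 (compress f D E w) =
    (row_mx A D)^t* *m f w *m row_mx B E.
  rewrite adj_row mul_col_mx mul_col_row.
  have DA : D^t* *m A = 0 by rewrite -[LHS]adj_adj adj_mul adj_adj AD adj0.
  case: w => [|j [|j' s]].
  - by rewrite /compress /= f0 !mulmx0 !mul0mx.
  - have Af : A^t* *m f [:: j] = Lt j *m B^t*.
      by rewrite -[LHS]adj_adj adj_mul adj_adj fA adj_mul adj_adj.
    have fBj := fB j; rewrite /lin in fBj.
    rewrite /compress /= Af -(mulmxA (Lt j) _ B) BB mulmx1 -(mulmxA (Lt j) _ E) BE mulmx0.
    by rewrite -[D^t* *m _ *m B]mulmxA fBj mulmxA DA mul0mx.
  have /(_ isT) fl := left0 (j' :: s) j.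
  (* The word is rewritten with its last letter split off, the form required by [right0]. *)
  have fr : f [:: j, j' & s] *m B = 0.
    by have := right0 (belast j (j' :: s)) (last j (j' :: s)); rewrite cats1 -lastI; apply.
  by rewrite fl !mul0mx -[D^t* *m _ *m B]mulmxA fr mulmx0.
by rewrite !mulmxA UD mul1mx -mulmxA VE mulmx1.
Qed.
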